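(* Let $G$ be a connected graph of order $n$ and diameter $D\geq 3$. Let $G^*$ be the twin graph of $G$, and let $\alpha(G^* )$ be the number of vertices of $G^*$ of type $(K)$ or $(N)$. Then $\beta(G)=n-D$ if and only if $G^*$ is one of the following graphs: (1) $G^*\cong P_{D+1}$ and one of the following cases holds: (a) $\alpha(G^* )\leq 1$; (b) $\alpha(G^* )=2$, the two vertices of $G^*$ not of type $(1)$ are adjacent, and if one of them is a leaf of type $(K)$ then the other is also of type $(K)$; (c) $\alpha(G^* )=2$, the two vertices of $G^*$ not of type $(1)$ are at distance $2$ and both are of type $(N)$; or (d) $\alpha(G^* )=3$ and there is a vertex of type $(N)$ or $(K)$ adjacent to two vertices of type $(N)$. (2) $G^*\cong P_{D+1,k}$ for some $k\in\{3,\dots,D-1\}$, the degree-$3$ vertex $u_{k-1}^*$ of $G^*$ is of any type, each neighbour of $u_{k-1}^*$ is of type $(1N)$, and every other vertex is of type $(1)$. (3) $G^*\cong P'_{D+1,k}$ for some $k\in\{2,\dots,D-1\}$, the three vertices in the cycle are of type $(1K)$, and every other vertex is of type $(1)$.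
   Context: Graphs are finite, undirected and simple. A vertex $x$ of a connected graph $G$ resolves a pair of vertices $v,w$ if $\mathrm{dist}(v,x)\neq\mathrm{dist}(w,x)$. A set $S\subseteq V(G)$ is a resolving set of $G$ if every pair of distinct vertices of $G$ is resolved by some vertex in $S$. The metric dimension $\beta(G)$ is the minimum cardinality of a resolving set of $G$. Let $N(u)$ be the open neighbourhood and $N[u]=N(u)\cup\{u\}$ the closed neighbourhood of $u$. Two distinct vertices $u,v$ are twins if $N[u]=N[v]$ (adjacent twins) or $N(u)=N(v)$ (non-adjacent twins). The relation $u\equiv v$ iff $u=v$ or $u,v$ are twins is an equivalence relation on $V(G)$; write $v^*$ for the equivalence class of $v$. The twin graph $G^*$ has the equivalence classes as its vertices, with distinct $v^*,w^*$ adjacent in $G^*$ iff $vw\in E(G)$ (this is independent of the choice of representatives). For each $v^*\in V(G^* )$ the induced subgraph $G[v^*]$ is complete or has no edges. A vertex $v^*$ of $G^*$ is of type $(1)$ if $|v^*|=1$; of type $(K)$ if $|v^*|\geq2$ and $G[v^*]$ is a complete graph; of type $(N)$ if $|v^*|\geq2$ and $G[v^*]$ has no edges. Type $(1K)$ means type $(1)$ or $(K)$; type $(1N)$ means type $(1)$ or $(N)$. $P_{D+1}=(u_0,u_1,\dots,u_D)$ denotes the path with $D+1$ vertices (length $D$). For $k\in\{3,\dots,D-1\}$, $P_{D+1,k}$ is the graph obtained from $P_{D+1}$ by adding one new vertex adjacent to $u_{k-1}$ only. For $k\in\{2,\dots,D-1\}$, $P'_{D+1,k}$ is the graph obtained from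 $P_{D+1}$ by adding one new vertex adjacent to exactly $u_{k-1}$ and $u_k$. When $G^*$ is isomorphic to one of these graphs, $u_i^*$ denotes the vertex of $G^*$ corresponding to $u_i$. A leaf is a vertex of degree $1$. *)

(* Defs.v *)
From mathcomp Require Import all_boot.

Set Implicit Arguments.
Unset Strict Implicit.
Unset Printing Implicit Defensive.

Record sgraph := SGraph {
  vertex :> finType;
  adj : rel vertex;
  adj_sym : symmetric adj;
  adj_irr : irreflexive adj
}.

Section Metric.
Variable G : sgraph.
Implicit Types (x y v w : G) (S : {set G}).

Definition connected := forall x y, connect (@adj G) x y.

Definition walk x y (l : nat) :=
  [exists p : l.-tuple G, path (@adj G) x p && (last x p == y)].

(* The least length of a walk from [x] to [y].  Shortest walks have length less
   than #|G|, which is therefore the value in the absence of walks. *)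
Definition dist x y : nat := find (walk x y) (iota 0 #|G|).

Definition diameter : nat := \max_(x : G) \max_(y : G) dist x y.

Definition resolves x v w := dist v x != dist w x.

Definition resolving S :=
  [forall v, forall w, (v != w) ==> [exists x in S, resolves x v w]].

(* The default [setT] is resolving, as [x] resolves every pair [x], [w]. *)
Definition metric_dim : nat := #|[arg min_(S < setT | resolving S) #|S|]|.

Definition open_nbh v : {set G} := [set w | adj v w].
Definition closed_nbh v : {set G} := v |: open_nbh v.

Definition degree v := #|open_nbh v|.
Definition leaf v := degree v == 1.

Definition twins v w :=
  (v != w) && ((closed_nbh v == closed_nbh w) || (open_nbh v == open_nbh w)).

Definition twin_class v : {set G} := [set w | (v == w) || twins v w].
Definition twin_classes : {set {set G}} := [set twin_class v | v : G].

End Metric.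

Section TwinGraph.
Variable G : sgraph.

Definition twin_vertex : finType := {C : {set G} | C \in twin_classes G}.

(* Adjacency does not depend on the representatives [v] and [w]. *)
Definition twin_adj : rel twin_vertex := fun C C' =>
  (C != C') && [exists v in val C, exists w in val C', adj v w].

Fact twin_adj_sym : symmetric twin_adj.
Proof.
move=> C C'; rewrite /twin_adj eq_sym; congr (_ && _).
by apply/exists_inP/exists_inP => -[v Cv /exists_inP[w Cw vw]];
   exists w => //; apply/exists_inP; exists v => //; rewrite adj_sym.
Qed.

Fact twin_adj_irr : irreflexive twin_adj.
Proof. by move=> C; rewrite /twin_adj eqxx. Qed.

Definition twin_graph : sgraph := SGraph twin_adj_sym twin_adj_irr.

Implicit Type C : twin_graph.

Definition type1 C := #|val C| == 1.
Definition typeK C :=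
  (2 <= #|val C|) &&
  [forall v in val C, forall w in val C, (v != w) ==> adj v w].
Definition typeN C :=
  (2 <= #|val C|) && [forall v in val C, forall w in val C, ~~ adj v w].
Definition type1K C := type1 C || typeK C.
Definition type1N C := type1 C || typeN C.

Definition alpha : nat := #|[set C | typeK C || typeN C]|.

End TwinGraph.

Definition is_iso (G H : sgraph) (f : G -> H) :=
  bijective f /\ (forall x y, adj (f x) (f y) = adj x y).

Definition isomorphic (G H : sgraph) := exists f : G -> H, is_iso f.

Section Path.
Variable D : nat.

Definition path_adj : rel 'I_D.+1 := fun i j =>
  (i.+1 == j :> nat) || (j.+1 == i :> nat).

Fact path_adj_sym : symmetric path_adj.
Proof. by move=> i j; rewrite /path_adj orbC. Qed.

Fact path_adj_irr : irreflexive path_adj.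
Proof. by move=> i; rewrite /path_adj orbb gtn_eqF. Qed.

(* The path (u_0, ..., u_D), with D + 1 vertices. *)
Definition path_graph : sgraph := SGraph path_adj_sym path_adj_irr.

(* [u i] is the vertex u_i when i <= D, and u_0 otherwise. *)
Definition u (i : nat) : path_graph := inord i.

End Path.

Section AddVertex.
Variables (G : sgraph) (A : {set G}).

(* [None] is the new vertex, and [A] its set of neighbours. *)
Definition add_adj : rel (option G) := fun x y =>
  match x, y with
  | Some v, Some w => adj v w
  | Some v, None | None, Some v => v \in A
  | None, None => false
  end.

Fact add_adj_sym : symmetric add_adj.
Proof. by move=> [v|] [w|] //=; rewrite adj_sym. Qed.

Fact add_adj_irr : irreflexive add_adj.
Proof. by move=> [v|] //=; rewrite adj_irr. Qed.

Definition add_vertex : sgraph := SGraph add_adj_sym add_adj_irr.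

End AddVertex.

(* P_{D+1,k}, meant for 3 <= k <= D - 1 *)
Definition path_pendant (D k : nat) : sgraph :=
  add_vertex [set u D k.-1].

(* P'_{D+1,k}, meant for 2 <= k <= D - 1 *)
Definition path_triangle (D k : nat) : sgraph :=
  add_vertex [set u D k.-1; u D k].

Section Cases.
Variables (G : sgraph) (D : nat).
Let Gs := twin_graph G.

Definition case1a := alpha G <= 1.

Definition case1b :=
  alpha G = 2 /\
  forall C C' : Gs, C != C' -> ~~ type1 C -> ~~ type1 C' ->
    adj C C' /\ (leaf C -> typeK C -> typeK C').

Definition case1c :=
  alpha G = 2 /\
  forall C C' : Gs, C != C' -> ~~ type1 C -> ~~ type1 C' ->
    [/\ dist C C' = 2, typeN C & typeN C'].

Definition case1d :=
  alpha G = 3 /\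
  exists C A B : Gs,
    [/\ typeN C || typeK C, A != B, adj C A && adj C B, typeN A & typeN B].

Definition case1 :=
  isomorphic (path_graph D) Gs /\ [\/ case1a, case1b, case1c | case1d].

(* The isomorphism [f] names the vertices of the twin graph: u_i^* is
   [f (Some (u D i))]. *)
Definition case2 :=
  exists2 k : nat, 3 <= k <= D.-1 &
  exists2 f : path_pendant D k -> Gs, is_iso f &
  let c := f (Some (u D k.-1)) in
  (forall C : Gs, adj c C -> type1N C) /\
  (forall C : Gs, C != c -> ~~ adj c C -> type1 C).

Definition case3 :=
  exists2 k : nat, 2 <= k <= D.-1 &
  exists2 f : path_triangle D k -> Gs, is_iso f &
  let cycle := [set f None; f (Some (u D k.-1)); f (Some (u D k))] in
  forall C : Gs, if C \in cycle then type1K C else type1 C.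

End Cases.

(* Main.v *)
Require Import Defs.
From mathcomp Require Import all_boot.
From mathcomp Require Import zify.

Set Implicit Arguments.
Unset Strict Implicit.
Unset Printing Implicit Defensive.

(**
A set [S] is resolving iff its complement [T] is coresolving: vertices of [T]
are pairwise separated from outside [T].  One vertex from each layer of
positive distance to an end [r] of a diametral path forms a coresolving set of
size [D], so the metric dimension is [n - D] iff no coresolving set is larger.

If none is, let [x], [y] be non-twins in the same layer from [r].  Any other
vertex resolving them is alone in its layer, which is not that of [x] (else one
could enlarge a layer transversal).  This forces: a layer is complete or empty;
non-twins occur in at most one layer [m], which splits into two classes, only
one of them adjacent to the unique vertex of layer [m + 1]; all later layers
are singletons.  Without such a layer the twin graph is a path.  With it, the
lower class of layer [m] folds back onto an earlier class, giving a path, or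
forms the extra vertex of P' (complete layer) or P (empty layer); the types on
the other side follow by exchanging the two ends of the diametral path.

Conversely a coresolving set meets each twin class at most once.  On a path a
larger one is a transversal, resolved from outside exactly by the classes of
size at least two, and this is a computation with the distances |i - j|.  In P
and P' it misses at most one class, and then two of the three branches still
contain a pair of vertices that nothing outside separates.
*)

(** * Walks, distances and twins *)

Section Walk.
Variable G : sgraph.
Implicit Types (x y z v w : G) (l : nat).

Lemma walk0 x y : walk x y 0 = (x == y).
Proof.
apply/existsP/eqP => [[p]|->]; first by rewrite tuple0 => /eqP.
by exists [tuple]; rewrite /= eqxx.
Qed.

Lemma walkS x y l : walk x y l.+1 = [exists z, adj x z && walk z y l].
Proof.
apply/existsP/existsP => [[p]|[z /andP[xz /existsP[p /andP[zp yp]]]]].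
  case/tupleP: p => z p /= /andP[/andP[xz zp] yp].
  by exists z; rewrite xz; apply/existsP; exists p; rewrite zp.
by exists [tuple of z :: p]; rewrite /= xz zp.
Qed.

Lemma walk1 x y : walk x y 1 = adj x y.
Proof.
rewrite walkS; apply/existsP/idP => [[z /andP[xz]]|xy].
  by rewrite walk0 => /eqP<-.
by exists y; rewrite xy walk0 /=.
Qed.

Lemma walk_trans x y z l l' : walk x y l -> walk y z l' -> walk x z (l + l').
Proof.
elim: l x => [|l IHl] x; first by rewrite walk0 => /eqP->.
rewrite addSn !walkS => /existsP[v /andP[xv vy]] yz.
by apply/existsP; exists v; rewrite xv IHl.
Qed.

Lemma walk_sym x y l : walk x y l -> walk y x l.
Proof.
elim: l x => [|l IHl] x; first by rewrite !walk0 eq_sym.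
rewrite walkS => /existsP[v /andP[xv /IHl yv]]; rewrite -addn1.
by apply: walk_trans yv _; rewrite walk1 adj_sym.
Qed.

Lemma dist_le_walk x y l : walk x y l -> dist x y <= l.
Proof.
move=> xy; rewrite /dist leqNgt; apply/negP => lt_l.
have l_lt : l < #|G|.
  by rewrite (leq_trans lt_l) // (leq_trans (find_size _ _)) ?size_iota.
by have := before_find 0 lt_l; rewrite nth_iota // add0n xy.
Qed.

Lemma walk_dist x y : dist x y < #|G| -> walk x y (dist x y).
Proof.
move=> lt_G; have has_w : has (walk x y) (iota 0 #|G|).
  by rewrite has_find size_iota.
by have := nth_find 0 has_w; rewrite nth_iota.
Qed.

End Walk.

Section Distance.
Variable G : sgraph.
Hypothesis connG : connected G.
Implicit Types (x y z v w : G) (l : nat).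

(** A duplicate-free path has fewer than [#|G|] edges, so the default value of [dist] does not occur
    in a connected graph. *)
Lemma dist_lt_card x y : dist x y < #|G|.
Proof.
have /connectP[p] := connG x y; case/shortenP => q xq uq _ ->.
have lt_q : size q < #|G| by rewrite (leq_trans _ (max_card [in x :: q])) ?(card_uniqP uq).
apply: leq_ltn_trans lt_q; apply: dist_le_walk.
by apply/existsP; exists (in_tuple q); rewrite /= xq eqxx.
Qed.

Lemma walk_distC x y : walk x y (dist x y).
Proof. exact/walk_dist/dist_lt_card. Qed.

Lemma dist_eq0 x y : (dist x y == 0) = (x == y).
Proof.
apply/eqP/eqP => [xy0|->]; first by apply/eqP; rewrite -walk0 -xy0 walk_distC.
by apply/eqP; rewrite -leqn0 dist_le_walk ?walk0.
Qed.

Lemma distxx x : dist x x = 0.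
Proof. by apply/eqP; rewrite dist_eq0. Qed.

Lemma dist_gt0 x y : (0 < dist x y) = (x != y).
Proof. by rewrite lt0n dist_eq0. Qed.

Lemma dist_sym x y : dist x y = dist y x.
Proof.
by apply/eqP; rewrite eqn_leq !dist_le_walk //; apply/walk_sym/walk_distC.
Qed.

Lemma dist_trans x y z : dist x z <= dist x y + dist y z.
Proof. exact/dist_le_walk/walk_trans/walk_distC/walk_distC. Qed.

Lemma dist_eq1 x y : (dist x y == 1) = adj x y.
Proof.
apply/eqP/idP => [xy1|xy]; first by rewrite -walk1 -xy1 walk_distC.
apply/eqP; rewrite eqn_leq dist_le_walk ?walk1 //= dist_gt0.
by apply: contraTneq xy => ->; rewrite adj_irr.
Qed.

Lemma dist_adj x y : adj x y -> dist x y = 1.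
Proof. by rewrite -dist_eq1 => /eqP. Qed.

Lemma dist_adj_le x y z : adj y z -> dist x z <= (dist x y).+1.
Proof. by move/dist_adj=> yz; have := dist_trans x y z; rewrite yz addn1. Qed.

Lemma dist_step x y l : dist x y = l.+1 -> exists2 z, adj x z & dist z y = l.
Proof.
move=> xyl; have := walk_distC x y; rewrite xyl walkS => /existsP[z /andP[xz]].
move=> /dist_le_walk zy; exists z => //.
by have := dist_trans x z y; rewrite (dist_adj xz) xyl add1n ltnS; lia.
Qed.

Lemma dist_eq2 x y z : x != y -> ~~ adj x y -> adj x z -> adj z y -> dist x y = 2.
Proof.
rewrite -dist_gt0 -dist_eq1 => xy xy1 xz zy.
by have := dist_adj_le x zy; rewrite (dist_adj xz); lia.
Qed.

Lemma geodesic x w i : i <= dist x w ->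
  exists2 v, dist x v = i & dist v w = dist x w - i.
Proof.
elim: i => [|i IHi] le_i; first by exists x; rewrite ?distxx ?subn0.
have [v xv vw] := IHi (ltnW le_i); have vwS : dist v w = (dist x w - i.+1).+1 by lia.
have [z vz zw] := dist_step vwS; exists z => //.
by have := dist_adj_le x vz; have := dist_trans x z w; lia.
Qed.

(* Collapsing [A] to [t] is a retraction that does not increase distances. *)
Lemma dist_retract (A : {set G}) s t w :
    s \notin A -> w \in A ->
    (forall x y, x \notin A -> y \in A -> adj x y -> x = t \/ adj x t) ->
  dist s t <= dist s w.
Proof.
move=> sA wA exitA; pose r v := if v \in A then t else v.
have r_adj x y : adj x y -> dist (r x) (r y) <= 1.
  rewrite /r => xy; case: ifP => xA; case: ifP => yA; rewrite ?distxx //.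
  - rewrite adj_sym in xy; case: (exitA _ _ (negbT yA) xA xy) => [->|yt].
      by rewrite distxx.
    by rewrite dist_sym dist_adj.
  - by case: (exitA _ _ (negbT xA) yA xy) => [->|xt]; rewrite ?distxx ?dist_adj.
  - by rewrite dist_adj.
have r_walk x y l : walk x y l -> dist (r x) (r y) <= l.
  elim: l x => [|l IHl] x; first by rewrite walk0 => /eqP->; rewrite distxx.
  rewrite walkS => /existsP[v /andP[/r_adj xv /IHl vy]].
  by have := dist_trans (r x) (r v) (r y); lia.
by have := r_walk _ _ _ (walk_distC s w); rewrite /r wA (negPf sA).
Qed.

End Distance.

(** The two pairs are linked through the pair [v], [w'] by moving one endpoint at a time, unless
    [v = w']. This will show that twin classes and layers are complete or empty. *)
Lemma homogeneous (G : sgraph) (P : G -> Prop) :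
    (forall a b c, P a -> P b -> P c -> a != b -> a != c -> adj a b = adj a c) ->
  forall v v' w w', P v -> P v' -> P w -> P w' -> v != v' -> w != w' ->
  adj v v' = adj w w'.
Proof.
move=> adj3 v v' w w' Pv Pv' Pw Pw' vv' ww'; rewrite eq_sym in ww'.
have [vw | vw] := eqVneq v w'.
  by rewrite [RHS]adj_sym -vw; apply: adj3; rewrite // vw.
by rewrite (adj3 v v' w') // adj_sym [RHS]adj_sym; apply: adj3; rewrite // eq_sym.
Qed.

Section Twins.
Variable G : sgraph.
Implicit Types (x y z v w : G) (l : nat).

(** One condition covers equality and both kinds of twins: the adjacency of [v] and [w] only decides
    which kind occurs. *)
Lemma twin_classP v w :
  reflect (forall z, z != v -> z != w -> adj z v = adj z w) (w \in twin_class v).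
Proof.
rewrite inE; have [-> | vw] := eqVneq v w; first by constructor.
rewrite /= /twins vw /=; apply: (iffP orP) => [[] /eqP/setP eqN z zv zw|eqN].
- by have := eqN z; rewrite !inE (negPf zv) (negPf zw) /= ![adj _ z]adj_sym.
- by have := eqN z; rewrite !inE ![adj _ z]adj_sym.
case: (boolP (adj v w)) => [vw1 | vw0]; [left | right]; apply/eqP/setP => z.
  rewrite !inE; have [-> | zv] := eqVneq z v; first by rewrite adj_sym vw1 orbT.
  have [-> | zw] := eqVneq z w; first by rewrite vw1.
  by rewrite /= ![adj _ z]adj_sym eqN.
rewrite !inE; have [-> | zv] := eqVneq z v.
  by rewrite adj_irr adj_sym (negPf vw0).
have [-> | zw] := eqVneq z w; first by rewrite adj_irr (negPf vw0).
by rewrite ![adj _ z]adj_sym eqN.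
Qed.

Lemma twin_class_refl v : v \in twin_class v.
Proof. by rewrite inE eqxx. Qed.

Lemma twin_class_sym v w : (v \in twin_class w) = (w \in twin_class v).
Proof. by apply/twin_classP/twin_classP => vw z zv zw; rewrite vw. Qed.

Lemma twin_class_trans v w x :
  w \in twin_class v -> x \in twin_class w -> x \in twin_class v.
Proof.
move=> vw wx; have [<- | v_neq_x] := eqVneq v x; first exact: twin_class_refl.
have [<- // | w_neq_v] := eqVneq w v; have [<- // | w_neq_x] := eqVneq w x.
move/twin_classP in vw; move/twin_classP in wx.
(* For [z = w] neither hypothesis applies to [z]; one passes through the adjacency of [v] and [x]
   instead. *)
apply/twin_classP => z zv zx; have [-> | zw] := eqVneq z w; last by rewrite vw ?wx.
have v_neq_w : v != w by rewrite eq_sym.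
have x_neq_v : x != v by rewrite eq_sym.
have x_neq_w : x != w by rewrite eq_sym.
by rewrite adj_sym wx // adj_sym vw // adj_sym.
Qed.

Lemma eq_twin_class v w : (twin_class v == twin_class w) = (w \in twin_class v).
Proof.
apply/eqP/idP => [->|vw]; first exact: twin_class_refl.
apply/setP => x; apply/idP/idP; last exact: twin_class_trans.
by apply: twin_class_trans; rewrite twin_class_sym.
Qed.

Lemma twin_adjP v w z : w \in twin_class v -> z != v -> z != w -> adj z v = adj z w.
Proof. by move/twin_classP; apply. Qed.

Lemma twin_homogeneous x v v' w w' :
    v \in twin_class x -> v' \in twin_class x -> w \in twin_class x ->
    w' \in twin_class x -> v != v' -> w != w' ->
  adj v v' = adj w w'.
Proof.
apply: (homogeneous (P := fun v => v \in twin_class x)) => a b c xa xb xc.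
by apply: twin_adjP; apply: twin_class_trans xc; rewrite twin_class_sym.
Qed.

(** Collapsing either twin onto the other is a retraction, so neither is farther from [z] than the
    other. *)
Lemma twin_dist v w z : connected G ->
  w \in twin_class v -> z != v -> z != w -> dist z v = dist z w.
Proof.
move=> connG vw zv zw; apply/eqP; rewrite eqn_leq.
have le x y : y \in twin_class x -> z != x -> z != y -> dist z x <= dist z y.
  move=> xy zx zy; apply: (@dist_retract _ _ [set y]); rewrite ?inE // => a b.
  rewrite !inE => ay /eqP->; have [-> | ax] := eqVneq a x; first by left.
  by rewrite -(twin_adjP xy ax ay); right.
by rewrite !le // twin_class_sym.
Qed.

End Twins.

(** * Coresolving sets and distance layers *)

Section Coresolving.
Variable G : sgraph.
Hypothesis connG : connected G.
Implicit Types (x y v w : G) (S T : {set G}).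

Definition coresolving T :=
  forall v w, v \in T -> w \in T -> v != w ->
  exists2 x, x \notin T & dist v x != dist w x.

(** A vertex of [S] resolves every pair that contains it, so only pairs inside the complement impose
    a condition. *)
Lemma resolvingP S : reflect (coresolving (~: S)) (resolving S).
Proof.
apply: (iffP forallP) => [resS v w Sv Sw vw | coS v].
  have /exists_inP[x Sx xvw] := implyP (forallP (resS v) w) vw.
  by exists x; rewrite // inE negbK.
apply/forallP => w; apply/implyP => vw; apply/exists_inP.
have [Sv | Sv] := boolP (v \in S).
  by exists v; rewrite // /resolves distxx // eq_sym dist_eq0 // eq_sym.
have [Sw | Sw] := boolP (w \in S).
  by exists w; rewrite // /resolves distxx // dist_eq0.
case: (coS v w); rewrite ?inE // => x; rewrite inE negbK => Sx xvw.
by exists x.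
Qed.

(** The set of size [D] bounds the metric dimension by [#|G| - D], so equality fails exactly when a
    larger coresolving set exists. *)
Lemma metric_dim_cardP D : D <= #|G| ->
    (exists2 T, coresolving T & #|T| = D) ->
  metric_dim G = #|G| - D <-> forall T, coresolving T -> #|T| <= D.
Proof.
move=> leDG [T0 coT0 cardT0].
have resT : resolving [set: G] by apply/resolvingP => v w; rewrite !inE.
rewrite /metric_dim; case: arg_minnP => // S resS minS.
have cardSC := cardsC S; have coS : coresolving (~: S) by apply/resolvingP.
have co_card T : coresolving T -> #|S| + #|T| <= #|G|.
  move=> coT; rewrite -(cardsC T) addnC leq_add2l minS //.
  by apply/resolvingP; rewrite setCK.
have := co_card _ coT0; split => [cardS T /co_card | maxT]; first by lia.
by have := maxT _ coS; lia.
Qed.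

(** A vertex outside [T] differs from both twins, hence is equidistant from them. *)
Lemma coresolving_twin T v w :
  coresolving T -> v \in T -> w \in T -> w \in twin_class v -> v = w.
Proof.
move=> coT Tv Tw vw; apply/eqP/negPn/negP => v_neq_w.
have [x Tx] := coT v w Tv Tw v_neq_w; rewrite 2!(dist_sym connG _ x).
by rewrite (twin_dist connG vw) ?eqxx //; apply: contraNneq Tx => ->.
Qed.

End Coresolving.

Section Layers.
Variables (G : sgraph) (D : nat) (r : G).
Hypothesis connG : connected G.
Hypothesis dist_r_max : exists w, dist r w = D.
Implicit Types (x y z v w : G).

Lemma layer_nonempty j : j <= D -> exists w, dist r w = j.
Proof. by have [w <-] := dist_r_max; move=> /(geodesic connG)[v rv _]; exists v. Qed.

(** The root stays outside, being alone in layer 0, and separates the other layers. The index is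
    shifted by one to skip layer 0. *)
Lemma coresolving_transversal (g : 'I_D -> G) :
    (forall j, dist r (g j) = j.+1) ->
  coresolving [set g j | j : 'I_D] /\ #|[set g j | j : 'I_D]| = D.
Proof.
move=> dg; split; last first.
  by rewrite card_imset ?card_ord // => i j /(congr1 (dist r)); rewrite !dg => -[/val_inj].
move=> _ _ /imsetP[i _ ->] /imsetP[j _ ->] gij; exists r.
  by apply/imsetP => -[k _ rk]; have := dg k; rewrite -rk distxx.
rewrite 2!(dist_sym connG _ r) !dg eqSS; apply: contraNneq gij => /val_inj->.
exact: eqxx.
Qed.

Lemma coresolving_diameter : exists2 T : {set G}, coresolving T & #|T| = D.
Proof.
have [g dg] : exists g : 'I_D -> G, forall j, dist r (g j) = j.+1.
  by apply: (@fin_all_exists 'I_D (fun _ => G) (fun j w => dist r w = j.+1)) => j; apply: layer_nonempty.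
by have [] := coresolving_transversal dg; exists [set g j | j : 'I_D].
Qed.

Hypothesis maxT : forall T : {set G}, coresolving T -> #|T| <= D.

(* Otherwise [x], [y] and one vertex other than [z] in each further layer would
   form a set resolved from outside by [r] and [z]. *)
Lemma resolver_layer x y z : dist r x = dist r y -> z != x -> z != y ->
    dist z x != dist z y ->
  dist r z != dist r x /\ (forall w, dist r w = dist r z -> w = z).
Proof.
move=> rxy zx zy zxy.
have x_neq_y : x != y by apply: contraNneq zxy => ->.
have rx : 0 < dist r x.
  rewrite dist_gt0 //; apply: contraNneq x_neq_y => r_x.
  by rewrite -(dist_eq0 connG) -{1}r_x -rxy -r_x distxx.
have zr : z != r by apply: contraNneq zxy => ->; rewrite rxy.
(* If either conclusion fails, every layer other than that of [x] has a vertex different from [z]: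
   either [z] lies in the layer of [x], or its own layer has a second vertex. *)
suff: ~ forall j, 0 < j <= D -> j != dist r x -> exists2 w, dist r w = j & w != z.
  move=> H; split.
    apply/negP => /eqP rz; apply: H => j /andP[_ /layer_nonempty[w rw]] jx.
    by exists w => //; apply: contraNneq jx => wz; rewrite -rw wz rz.
  move=> w rw; apply/eqP/negPn/negP => wz; apply: H => j /andP[_ leD] jx.
  have [-> | jz] := eqVneq j (dist r z); first by exists w.
  have [v rv] := layer_nonempty leD; exists v => //.
  by apply: contraNneq jz => <-; rewrite rv.
move=> H; have [g gP] : exists g : 'I_D -> G, forall j : 'I_D,
    [/\ dist r (g j) = j.+1, g j != z & j.+1 = dist r x -> g j = x].
  apply: (@fin_all_exists 'I_D (fun _ => G) (fun (j : 'I_D) w =>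
    [/\ dist r w = j.+1, w != z & j.+1 = dist r x -> w = x])) => j.
  have [jx | jx] := eqVneq j.+1 (dist r x); first by exists x; rewrite eq_sym.
  have [w rw wz] := H j.+1 (ltn_ord j) jx; exists w; split=> // jx'.
  by rewrite jx' eqxx in jx.
have dg j : dist r (g j) = j.+1 by case: (gP j).
have [coT cardT] := coresolving_transversal dg.
set T := [set g j | j : 'I_D] in coT cardT.
have rT : r \notin y |: T.
  rewrite !inE negb_or -dist_gt0 // -rxy rx /=.
  by apply/imsetP => -[j _ rj]; have := dg j; rewrite -rj distxx.
have zT : z \notin y |: T.
  rewrite !inE negb_or zy; apply/imsetP => -[j _ zj].
  by case: (gP j); rewrite zj eqxx.
have yT : y \notin T.
  apply: contra x_neq_y => /imsetP[j _ yj]; case: (gP j) => rj _.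
  by rewrite -rj -yj rxy => ->.
have dist_rT v w : v \in y |: T -> w \in y |: T -> v != w ->
  exists2 s, s \notin y |: T & dist v s != dist w s.
  have Tx v' : v' \in T -> dist r v' = dist r x -> v' = x.
    by case/imsetP => j _ -> rj; case: (gP j) => rj' _; apply; rewrite -rj.
  move=> Tv Tw vw; have [rvw | rvw] := eqVneq (dist r v) (dist r w); last first.
    by exists r; rewrite // 2!(dist_sym connG _ r).
  exists z; rewrite // 2!(dist_sym connG _ z).
  move: Tv Tw; rewrite !inE => /predU1P[vy | Tv] /predU1P[wy | Tw].
  - by rewrite vy wy eqxx in vw.
  - by rewrite vy (Tx w) // 1?eq_sym // -rvw vy.
  - by rewrite wy (Tx v) // rvw wy.
  - case/imsetP: Tv vw rvw => i _ ->; case/imsetP: Tw => j _ -> vw.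
    by rewrite !dg => -[/val_inj ij]; rewrite ij eqxx in vw.
have := maxT dist_rT; rewrite cardsU1 yT cardT; lia.
Qed.

(** A vertex [z] adjacent to just one of the two resolves them, so it is alone in a layer next to
    theirs. It cannot be the preceding layer: every vertex of the layer of [x] has a neighbour
    there, which would have to be [z]. *)
Lemma nontwin_layer x y : dist r x = dist r y -> y \notin twin_class x ->
  exists z, [/\ dist r z = (dist r x).+1, (forall w, dist r w = dist r z -> w = z)
              & adj z x != adj z y].
Proof.
move=> rxy xy.
have [z /and3P[zx zy zxy]] : exists z, [&& z != x, z != y & adj z x != adj z y].
  apply/existsP; apply: contraNT xy => /existsPn noz.
  apply/twin_classP => z zx zy; apply/eqP.
  by have := noz z; rewrite zx zy negbK.
have zxy' : dist z x != dist z y.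
  by apply: contraNneq zxy => zxy; rewrite -!(dist_eq1 connG) zxy.
have [rz zP] := resolver_layer rxy zx zy zxy'.
exists z; split=> //.
have : dist r z != (dist r x).-1.
  apply: contraNneq zxy => rzx.
  have adj_z v : dist r v = dist r x -> adj z v.
    move=> rv; have [l rvl] : exists l, dist r v = l.+1.
      by exists (dist r x).-1; move: rz rzx; rewrite rv; lia.
    have [w vw wr] : exists2 w, adj v w & dist w r = l.
      by apply: (dist_step connG); rewrite (dist_sym connG).
    by rewrite -(zP w) 1?adj_sym // dist_sym // wr rzx -rv rvl.
  by rewrite !adj_z.
move=> rz'; have [v rv zv] : exists2 v, dist r v = dist r x & adj v z.
  case: (boolP (adj z x)) zxy => [zx1 | _ zy1]; first by exists x; rewrite // adj_sym.
  by exists y; rewrite // adj_sym; case: (adj z y) zy1.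
have zv' : adj z v by rewrite adj_sym.
have := dist_adj_le connG r zv; have := dist_adj_le connG r zv'.
by move: rz rz'; rewrite rv; lia.
Qed.

(** A farther vertex [w] resolves a pair in the layer of [x]: one vertex [v] on a shortest path from
    [r] to [w], and [y], which lies on no such path. By [resolver_layer], [w] is then alone in its
    layer. *)
Lemma nontwin_above x y : dist r x = dist r y -> y \notin twin_class x ->
  forall w w', dist r x < dist r w -> dist r w' = dist r w -> w' = w.
Proof.
move=> rxy xy w w' lt_w; have [z [rz zP]] := nontwin_layer rxy xy.
wlog zy : x y rxy xy lt_w rz / ~~ adj z y.
  move=> IH zxy; have [zy | zy] := boolP (adj z y); last exact: (IH x y).
  rewrite twin_class_sym in xy; rewrite eq_sym in zxy.
  apply: (IH y x) (zxy) => //; rewrite -?rxy //.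
  by rewrite zy in zxy; case: (adj z x) zxy.
(* A shortest path from [r] to [w] through [y] would continue through [z], the only vertex of the
   next layer, but [z] is not adjacent to [y]. *)
move=> zxy; have yw : dist r w != dist r y + dist y w.
  apply/eqP => rw; have [l yl] : exists l, dist y w = l.+1.
    by exists (dist y w).-1; move: lt_w; rewrite rw rxy; lia.
  have [z' yz' z'w] := dist_step connG yl.
  have rz' : dist r z' = dist r z.
    by have := dist_adj_le connG r yz'; have := dist_trans connG r z' w; lia.
  by rewrite -(zP z' rz') adj_sym yz' in zy.
have [v rv vw] := geodesic connG (ltnW lt_w).
have vyw : dist w v != dist w y.
  by rewrite 2!(dist_sym connG w); move: yw; lia.
have wv : w != v by apply: contraTneq lt_w => ->; rewrite rv ltnn.
have wy : w != y by apply: contraTneq lt_w => ->; rewrite -rxy ltnn.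
have rvy : dist r v = dist r y by rewrite rv.
exact: (resolver_layer rvy wv wy vyw).2.
Qed.

(** A vertex adjacent to only one of two others in its layer would resolve them from inside that
    layer, which [resolver_layer] excludes. *)
Lemma layer_homogeneous x v v' w w' : dist r v = dist r x ->
    dist r v' = dist r x -> dist r w = dist r x -> dist r w' = dist r x ->
  v != v' -> w != w' -> adj v v' = adj w w'.
Proof.
apply: (homogeneous (P := fun v => dist r v = dist r x)) => a b c ra rb rc ab ac.
apply: contraTeq isT => abc; have abc' : dist a b != dist a c.
  by apply: contraNneq abc => abc; rewrite -!(dist_eq1 connG) abc.
by have [] := resolver_layer _ ab ac abc'; rewrite ?ra ?rb ?rc ?eqxx.
Qed.

(** Non-twins of the layer are told apart by a vertex of the next layer, and [z] is the only one. A
    layer thus splits into at most two classes. *)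
Lemma layer_twins x z v v' : dist r z = (dist r x).+1 ->
    (forall w, dist r w = dist r z -> w = z) ->
    dist r v = dist r x -> dist r v' = dist r x -> adj z v = adj z v' ->
  v' \in twin_class v.
Proof.
move=> rz zP rv rv' vv'; apply: contraTT isT => vv'N.
have rvv' : dist r v = dist r v' by rewrite rv.
have [z' [rz' _]] := nontwin_layer rvv' vv'N.
by rewrite (zP z') ?rz' ?rz ?rv // vv' eqxx.
Qed.

End Layers.

(** * Presenting the twin graph by a quotient map *)

Section Blowup.
Variables (G H : sgraph).
Implicit Types (x y v w : G) (h : H).

(** Such maps amount to isomorphisms from [H] to the twin graph, with the classes as fibres; they
    allow arguments on vertices of [G] instead of on sets of vertices. *)
Definition blowup (phi : G -> H) :=
  [/\ forall h, exists x, phi x = h,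
      forall x y, phi x != phi y -> adj x y = adj (phi x) (phi y)
    & forall x y, (phi x == phi y) = (y \in twin_class x)].

Lemma mem_twin_classes v : twin_class v \in twin_classes G.
Proof. exact: imset_f. Qed.

Definition to_twin v : twin_graph G := Sub (twin_class v) (mem_twin_classes v).

Lemma to_twinP (C : twin_graph G) : exists v, to_twin v = C.
Proof. by case: C => C CP; have /imsetP[v _ Cv] := CP; exists v; apply/val_inj. Qed.

Lemma eq_to_twin v w : (to_twin v == to_twin w) = (w \in twin_class v).
Proof. exact: eq_twin_class. Qed.

Lemma adj_to_twin v w : w \notin twin_class v ->
  adj (to_twin v) (to_twin w) = adj v w.
Proof.
move=> vw; rewrite /= /twin_adj eq_to_twin vw /=.
apply/exists_inP/idP => [[v' vv' /exists_inP[w' ww' vw']]|v_w]; last first.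
  exists v; first exact: twin_class_refl.
  by apply/exists_inP; exists w; first exact: twin_class_refl.
have neq a b : a \in twin_class v -> b \in twin_class w -> a != b.
  move=> va wb; apply: contraNneq vw => ab; apply: twin_class_trans va _.
  by rewrite twin_class_sym ab.
have vv := twin_class_refl v; have ww := twin_class_refl w.
rewrite adj_sym (twin_adjP vv') 1?[w == _]eq_sym ?neq //.
by rewrite adj_sym (twin_adjP ww') ?neq.
Qed.

(** The equation on fibres is kept because the types of the vertices of the twin graph are read off
    from it. *)
Lemma blowup_iso phi : blowup phi ->
  exists2 f : H -> twin_graph G, is_iso f & forall h, val (f h) = [set x | phi x == h].
Proof.
case=> surj_phi adj_phi fib_phi.
have [g phig] : exists g : H -> G, forall h, phi (g h) = h.
  exact: (@fin_all_exists H (fun _ => G) (fun h x => phi x = h)).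
have [c cP] : exists c : twin_graph G -> G, forall C, to_twin (c C) = C.
  apply: (@fin_all_exists (twin_vertex G) (fun _ => G) (fun C v => to_twin v = C)).
  exact: to_twinP.
exists (to_twin \o g) => [|h]; last first.
  by apply/setP => x; rewrite [RHS]inE -[in RHS](phig h) eq_sym fib_phi.
split=> [|h h'].
  exists (phi \o c) => [h | C] /=; last by rewrite -[RHS]cP; apply/eqP; rewrite eq_to_twin -fib_phi phig.
  by rewrite -[RHS]phig; apply/eqP; rewrite fib_phi -eq_to_twin cP.
have [-> | hh'] := eqVneq h h'; first by rewrite !adj_irr.
rewrite -[LHS]/(adj (to_twin _) (to_twin _)).
have ghh' : phi (g h) != phi (g h') by rewrite !phig.
by rewrite adj_to_twin -?fib_phi // adj_phi // !phig.
Qed.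

Lemma iso_blowup (f : H -> twin_graph G) : is_iso f ->
  exists2 phi, blowup phi & forall h, val (f h) = [set x | phi x == h].
Proof.
case=> -[f' fK f'K] adj_f; exists (f' \o to_twin) => [|h].
  have inj_f' := can_inj f'K.
  have fib x y : (f' (to_twin x) == f' (to_twin y)) = (y \in twin_class x).
    by rewrite inj_eq // eq_to_twin.
  split=> [h | x y /= xy | x y] //=.
    by have [v vh] := to_twinP (f h); exists v; rewrite /= vh fK.
  by rewrite -adj_f !f'K adj_to_twin // -fib.
apply/setP => x; rewrite inE /= -(inj_eq (can_inj fK)) f'K.
by have [v <-] := to_twinP (f h); rewrite eq_to_twin /= twin_class_sym.
Qed.

End Blowup.

(** * Twin graphs isomorphic to a path *)

(** The absolute difference: one of the two truncated differences is 0. *)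
Definition gap (i j : nat) := (i - j) + (j - i).

(* The distance from a vertex in the class of u_i to another vertex, in the
   class of u_a, when [k] tells whether the class of u_i is complete. *)
Definition class_dist (k : bool) (i a : nat) :=
  if a == i then (if k then 1 else 2) else gap i a.

(** On a path only the midpoint is equidistant from two positions. The value 1 or 2 within the class
    of [i] adds collisions with positions at that distance from [i]. *)
Lemma class_dist_collision k i a b : a < b -> class_dist k i a = class_dist k i b ->
  a + b = i.*2 \/ k /\ b = a.+1 /\ (i = a \/ i = b) \/
  ~~ k /\ b = a.+2 /\ (i = a \/ i = b).
Proof.
by rewrite /class_dist /gap; case: k; case: eqP => ai; case: eqP => bi ab abi /=; lia.
Qed.

Section Unresolved.
Variables (D : nat) (B : {set 'I_D.+1}) (K : pred nat).
Hypothesis D_ge3 : 3 <= D.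
Implicit Types (i j c : 'I_D.+1).

(** A vertex outside a transversal of all classes lies in a class with at least two vertices, that
    is, in [B]. Such a pair therefore obstructs every transversal from being coresolving. *)
Definition unresolved_pair := exists a b : nat,
  a < b <= D /\ forall i, i \in B -> class_dist (K i) i a = class_dist (K i) i b.

(** The four path cases in positions: [B] holds the classes not of type (1), its members outside [K]
    have type (N), and the leaves are at 0 and [D]. *)
Definition path_types :=
  [\/ #|B| <= 1,
      #|B| = 2 /\ (forall i j, i \in B -> j \in B -> i != j ->
         gap i j = 1 /\ ((i : nat) = 0 \/ i = D :> nat -> K i -> K j)),
      #|B| = 2 /\ (forall i j, i \in B -> j \in B -> i != j ->
         [/\ gap i j = 2, ~~ K i & ~~ K j])
    | #|B| = 3 /\ exists c i j,
         [/\ [/\ c \in B, i \in B & j \in B], i != j, gap c i = 1, gap c j = 1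
           & ~~ K i /\ ~~ K j]].

Lemma unresolved_path_types : unresolved_pair -> path_types.
Proof.
case=> a [b [/andP[ab bD] abP]].
have collB i : i \in B -> _ := fun Bi => class_dist_collision ab (abP i Bi).
have [B1 | B_gt1] := leqP #|B| 1; first exact: Or41.
have neqE i j : (i != j) = (i != j :> nat) by [].
(* Consecutive positions have no midpoint, so [B] lies in these two positions and both classes are
   complete. *)
have [b1 | b1] := eqVneq b a.+1.
  have B2 : #|B| = 2.
    have Bsub : B \subset [set inord a; inord b].
      by apply/subsetP => i /collB Bi; rewrite !inE -!val_eqE /= !inordK; lia.
    by have := subset_leq_card Bsub; rewrite cards2; lia.
  by apply: Or42; split=> // i j /collB Bi /collB Bj; rewrite neqE /gap; lia.
(* At distance at least 3 only the midpoint can collide. At distance 2 the middle class is of any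
   type and the two outer ones are of type (N) when big. *)
have [b2 | b2] := eqVneq b a.+2; last first.
  suff : #|B| <= 1 by rewrite leqNgt B_gt1.
  by apply/card_le1_eqP => i j /collB Bi /collB Bj; apply: val_inj => /=; lia.
have val3 i : i \in B ->
    i = a.+1 :> nat \/ ~~ K i /\ (i = a :> nat \/ i = a.+2 :> nat).
  by move/collB; lia.
have B_le3 : #|B| <= 3.
  have Bsub : B \subset [set inord a; inord a.+1; inord a.+2].
    by apply/subsetP => i /val3 Bi; rewrite !inE -!val_eqE /= !inordK; lia.
  apply: leq_trans (subset_leq_card Bsub) _; rewrite -setUA !cardsU1 cards1.
  by do 2![case: (_ \notin _)].
have [B3 | B3] := eqVneq #|B| 3.
  apply: Or44; split=> //.
  have /card_gt2P[i [j [k [[Bi Bj Bk]]]]] : 2 < #|B| by rewrite B3.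
  rewrite !neqE => -[ij jk ki].
  have := (val3 i Bi); have := val3 j Bj; have := val3 k Bk => vk vj vi.
  case: (eqVneq (i : nat) a.+1) => ia; last case: (eqVneq (j : nat) a.+1) => ja.
  - by exists i, j, k; rewrite /gap neqE; split; [|lia..].
  - by exists j, i, k; rewrite /gap neqE; split; [|lia..].
  - by exists k, i, j; rewrite /gap neqE; split; [|lia..].
have B2 : #|B| = 2 by lia.
(* With two big classes, the middle one being big or not distinguishes the adjacent case from the
   case of distance 2. *)
have [Ba1 | Ba1] := boolP (inord a.+1 \in B); last first.
  apply: Or43; split=> // i j Bi Bj; rewrite neqE /gap.
  have neq k : k \in B -> k != a.+1 :> nat.
    by move=> Bk; apply: contraNneq Ba1 => <-; rewrite inord_val.
  by have := (val3 i Bi, val3 j Bj, neq i Bi, neq j Bj) => -[[[vi vj] ni] nj]; split; lia.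
apply: Or42; split=> // i j Bi Bj ij.
have mid : i = a.+1 :> nat \/ j = a.+1 :> nat.
  case: (eqVneq (i : nat) a.+1) => ia; first by left.
  case: (eqVneq (j : nat) a.+1) => ja; first by right.
  suff : 2 < #|B| by rewrite B2.
  apply/card_gt2P; exists i, j, (inord a.+1); split=> //.
  by split; rewrite // -val_eqE /= inordK; lia.
move: ij (val3 i Bi) (val3 j Bj); rewrite neqE /gap => ij vi vj.
by split; [lia|]; case=> ie Ki; lia.
Qed.

Lemma path_types_unresolved : path_types -> unresolved_pair.
Proof.
have cd_eq (k : bool) (i a b : nat) : a != b ->
    a + b = i.*2 \/ k /\ b = a.+1 /\ (i = a \/ i = b) \/
      ~~ k /\ b = a.+2 /\ (i = a \/ i = b) ->
    class_dist k i a = class_dist k i b.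
  by rewrite /class_dist /gap; case: k => ab; do 2![case: eqP => ?]; lia.
have pair (a b : nat) : a < b <= D -> (forall i : 'I_D.+1, i \in B ->
    a + b = i.*2 \/ K i /\ b = a.+1 /\ (i = a :> nat \/ i = b :> nat) \/
      ~~ K i /\ b = a.+2 /\ (i = a :> nat \/ i = b :> nat)) -> unresolved_pair.
  move=> abD abP; exists a, b; split=> // i /abP Bi; apply: cd_eq => //; lia.
have neqE i j : (i != j) = (i != j :> nat) by [].
case=> [/card_le1_eqP B1 | [B2 BP] | [B2 BP] | [B3 [c [i [j]]]]].
- have [B0 | [i Bi]] := set_0Vmem B.
    by apply: (pair 0 1) => [|i]; [lia | rewrite B0 inE].
  have eq_i j : j \in B -> j = i by move=> Bj; apply: B1.
  (* A complete class collides with a neighbour, an empty one with a position two steps away;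
     [D >= 3] leaves room for that on one side. *)
  have i_lt := ltn_ord i; have [Ki | Ki] := boolP (K i).
    case: (ltnP i D) => iD.
      by apply: (pair i i.+1) => [|j /eq_i->]; lia.
    by apply: (pair i.-1 i) => [|j /eq_i->]; lia.
  case: (ltnP i.+1 D) => iD.
    by apply: (pair i i.+2) => [|j /eq_i->]; lia.
  by apply: (pair i.-2 i) => [|j /eq_i->]; lia.
- have /cards2P[i [j [ij BE]]] : #|B| == 2 by rewrite B2.
  have BPn k l : k \in B -> l \in B -> k < l -> l = k.+1 :> nat /\
    ((k : nat) = 0 -> K k -> K l) /\ (l = D :> nat -> K l -> K k).
    move=> Bk Bl kl; have kl' : k != l by rewrite neqE; lia.
    have [gkl kl1] := BP k l Bk Bl kl'; rewrite eq_sym in kl'.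
    have [_ lk1] := BP l k Bl Bk kl'; rewrite /gap in gkl.
    by split; [lia | split=> ?; [apply: kl1; left | apply: lk1; right]].
  have [k [l [kl Bkl]]] : exists k l : 'I_D.+1, k < l /\ forall m, m \in B = (m == k) || (m == l).
    rewrite neqE in ij; case: (ltnP i j) => ij'.
      by exists i, j; split=> // m; rewrite BE !inE.
    by exists j, i; split=> [|m]; [lia | rewrite BE !inE orbC].
  have Bk : k \in B by rewrite Bkl eqxx.
  have Bl : l \in B by rewrite Bkl eqxx orbT.
  have [lk [K0 KD]] := BPn k l Bk Bl kl; have l_lt := ltn_ord l.
  have inB m : m \in B -> m = k \/ m = l.
    by rewrite Bkl => /orP[/eqP|/eqP]; [left | right].
  (* Two complete classes form the pair themselves. Otherwise one is the midpoint and the other, of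
     type (N), an end of the pair; a lone complete class must be the midpoint, so it must not be a
     leaf. *)
  have [Kk | Kk] := boolP (K k); have [Kl | Kl] := boolP (K l).
  + by apply: (pair k l) => [|m /inB[]->]; lia.
  + case: (posnP k) => k0; first by rewrite (K0 k0 Kk) in Kl.
    by apply: (pair k.-1 l) => [|m /inB[]->]; lia.
  + case: (ltnP l D) => lD; last by rewrite KD // in Kk; lia.
    by apply: (pair k l.+1) => [|m /inB[]->]; lia.
  + case: (ltnP l D) => lD; first by apply: (pair k l.+1) => [|m /inB[]->]; lia.
    by apply: (pair k.-1 l) => [|m /inB[]->]; lia.
- have /cards2P[i [j [ij BE]]] : #|B| == 2 by rewrite B2.
  have [||gij Ki Kj] := BP i j _ _ ij; rewrite ?BE ?inE ?eqxx ?orbT //.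
  have inB m : m \in B -> m = i \/ m = j.
    by rewrite BE !inE => /orP[/eqP|/eqP]; [left | right].
  have [i_lt j_lt] := (ltn_ord i, ltn_ord j); rewrite neqE /gap in ij gij.
  case: (ltnP i j) => lt_ij.
    by apply: (pair i j) => [|m /inB[]->]; lia.
  by apply: (pair j i) => [|m /inB[]->]; lia.
case=> -[Bc Bi Bj] ij; rewrite /gap => ci cj [Ki Kj].
have inB m : m \in B -> m = c \/ m = i \/ m = j.
  suff -> : B = [set c; i; j].
    rewrite !inE => /orP[/orP[]|] /eqP; [by left | by right; left | by right; right].
  apply/eqP; rewrite eq_sym eqEcard B3 !subUset !sub1set Bc Bi Bj /=.
  rewrite -setUA cardsU1 cards2 !inE negb_or ij !neqE.
  have -> : (c : nat) != i by lia.
  have -> : (c : nat) != j by lia.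
  by [].
have [i_lt j_lt] := (ltn_ord i, ltn_ord j); rewrite neqE in ij.
case: (ltnP i j) => lt_ij.
  by apply: (pair i j) => [|m /inB[->|[]->]]; clear -lt_ij ci cj ij Ki Kj i_lt j_lt; lia.
by apply: (pair j i) => [|m /inB[->|[]->]]; clear -lt_ij ci cj ij Ki Kj i_lt j_lt; lia.
Qed.

End Unresolved.

Section PathLayout.
Variables (G : sgraph) (D : nat) (p : G -> nat).
Hypothesis connG : connected G.
Implicit Types (x y v w : G).

(** A blow-up of the path on [D + 1] vertices, with positions in [nat] so that distances become
    arithmetic. *)
Definition path_layout :=
  [/\ forall x, p x <= D, forall i, i <= D -> exists x, p x = i,
      forall x y, p x != p y -> adj x y = (gap (p x) (p y) == 1)
    & forall x y, (p x == p y) = (y \in twin_class x)].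

(** One adjacent pair suffices because twin classes are homogeneous; a singleton class counts as not
    complete. *)
Definition class_complete i :=
  [exists x, exists y, [&& p x == i, p y == i & adj x y]].

Definition big_classes : {set 'I_D.+1} :=
  [set i : 'I_D.+1 | [exists x, exists y, [&& x != y, p x == i & p y == i]]].

Hypothesis layout_p : path_layout.
Hypothesis D_gt0 : 0 < D.

Let p_le x : p x <= D. Proof. by case: layout_p. Qed.
Let p_surj i : i <= D -> exists x, p x = i. Proof. by case: layout_p; move=> _ H _ _; apply: H. Qed.
Let adj_p x y : p x != p y -> adj x y = (gap (p x) (p y) == 1).
Proof. by case: layout_p; move=> _ _ H _; apply: H. Qed.
Let p_twin x y : (p x == p y) = (y \in twin_class x). Proof. by case: layout_p. Qed.

Lemma layout_adj_le x y : adj x y -> gap (p x) (p y) <= 1.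
Proof.
by move=> xy; have [->|] := eqVneq (p x) (p y);
   [rewrite /gap; lia | move/adj_p; rewrite xy; lia].
Qed.

Lemma layout_dist x y : p x != p y -> dist x y = gap (p x) (p y).
Proof.
have lower l x' y' : walk x' y' l -> gap (p x') (p y') <= l.
  elim: l x' => [|l IHl] x'; first by rewrite walk0 /gap => /eqP->; lia.
  rewrite walkS => /existsP[z /andP[/layout_adj_le xz /IHl]].
  by move: xz; rewrite /gap; lia.
have upper l x' y' : p y' = p x' + l.+1 -> walk x' y' l.+1.
  elim: l x' => [|l IHl] x' py; first by rewrite walk1 adj_p /gap; lia.
  have [z pz] : exists z, p z = (p x').+1 by apply: p_surj; have := p_le y'; lia.
  rewrite walkS; apply/existsP; exists z; rewrite adj_p /gap ?IHl; lia.
wlog xy : x y / p x < p y => [IH xy | _].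
  case: (ltnP (p x) (p y)) => [lt_xy | le_yx]; first exact: IH lt_xy xy.
  by rewrite dist_sym // IH; rewrite /gap; lia.
apply/eqP; rewrite eqn_leq (lower _ _ _ (walk_distC connG x y)) andbT.
apply: dist_le_walk; have -> : gap (p x) (p y) = (p y - p x).-1.+1 by rewrite /gap; lia.
by apply: upper; lia.
Qed.

Lemma class_completeE x y : x != y -> p x = p y -> class_complete (p x) = adj x y.
Proof.
move=> xy pxy; apply/existsP/idP => [[v /existsP[w /and3P[/eqP pv /eqP pw vw]]]|xy1].
  rewrite -(@twin_homogeneous _ x v w) // -?p_twin ?pv ?pw ?pxy ?eqxx //.
  by apply: contraTneq vw => ->; rewrite adj_irr.
by exists x; apply/existsP; exists y; rewrite pxy eqxx.
Qed.

Lemma layout_class_dist x y : x != y ->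
  dist x y = class_dist (class_complete (p x)) (p x) (p y).
Proof.
move=> xy; rewrite /class_dist; case: eqP => [pyx | /eqP pxy]; last first.
  by rewrite layout_dist 1?eq_sym.
rewrite (class_completeE xy) //; case: ifPn => xy1; first exact: dist_adj.
(* A neighbouring class provides a common neighbour of the two non-adjacent twins; at position 0 it
   is the class on the other side. *)
have [z pz] : exists z, p z = if p x == 0 then 1 else (p x).-1.
  by apply: p_surj; have := p_le x; case: eqP; lia.
have [pzx gzx] : p z != p x /\ gap (p z) (p x) = 1.
  by move: pz; rewrite /gap; case: (eqVneq (p x) 0); split; lia.
have zx : adj z x by rewrite adj_p // gzx.
have zy : adj z y by rewrite adj_p pyx // gzx.
by apply: (dist_eq2 connG xy xy1 _ zy); rewrite adj_sym.
Qed.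

(** A coresolving set with more than [D] vertices is a transversal of all [D + 1] classes, and the
    vertices outside it see exactly the distances [class_dist]. *)
Lemma layout_max_coresolving :
  (forall T : {set G}, coresolving T -> #|T| <= D) <->
  unresolved_pair big_classes class_complete.
Proof.
pose q x : 'I_D.+1 := inord (p x).
have pK x : q x = p x :> nat by rewrite inordK ?ltnS.
split=> [maxT | [a [b [/andP[ab bD] abP]]] T coT].
  have [g pg] : exists g : 'I_D.+1 -> G, forall i, p (g i) = i.
    apply: (@fin_all_exists 'I_D.+1 (fun _ => G) (fun i x => p x = i)) => i.
    by apply: p_surj; rewrite -ltnS.
  pose unres (a b : 'I_D.+1) := [forall i in big_classes,
    class_dist (class_complete i) i a == class_dist (class_complete i) i b].
  have [/existsP[a /existsP[b /andP[ab /forall_inP abP]]] | noab] :=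
      boolP [exists a : 'I_D.+1, exists b : 'I_D.+1, (a < b) && unres a b].
    by exists a, b; split=> [|i /abP/eqP //]; rewrite ab -ltnS ltn_ord.
  have inj_g : injective g by move=> i j /(congr1 p); rewrite !pg => /val_inj.
  have noab' (a b : 'I_D.+1) : a != b -> ~~ unres a b.
    wlog lt_ab : a b / a < b => [IH ab | _].
      case: (ltnP a b) => [/IH|]; first exact.
      rewrite leq_eqVlt (_ : _ == _ = false) /=; last by rewrite eq_sym; apply/negbTE.
      move=> ba; rewrite eq_sym in ab; apply: contra (IH _ _ ba ab) => /forall_inP abP.
      by apply/forall_inP => i /abP; rewrite eq_sym.
    by apply: contra noab => abP; apply/existsP; exists a; apply/existsP; exists b; rewrite lt_ab.
  suff /maxT : coresolving [set g i | i : 'I_D.+1] by rewrite card_imset // card_ord ltnn.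
  move=> _ _ /imsetP[a _ ->] /imsetP[b _ ->] gab.
  have ab : a != b by apply: contraNneq gab => ->.
  have /forall_inPn[i] := noab' a b ab; rewrite inE => /existsP[x /existsP[y]].
  case/and3P=> xy /eqP px /eqP py iab.
  (* The class has two vertices, so one of them is off the transversal and serves as resolver. *)
  have [z pz gz] : exists2 z, p z = i & z != g i.
    by have [xg | xg] := eqVneq x (g i); [exists y; rewrite // -xg eq_sym | exists x].
  have zT : z \notin [set g i | i : 'I_D.+1].
    apply: contra gz => /imsetP[j _ zj]; suff -> : i = j by apply/eqP.
    by apply: val_inj; rewrite /= -pz zj pg.
  exists z; rewrite // 2!(dist_sym connG _ z) !layout_class_dist ?pz ?pg //.
    by apply: contraNneq zT => ->; apply: imset_f.
  by apply: contraNneq zT => ->; apply: imset_f.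
have inj_p : {in T &, injective q}.
  move=> x y Tx Ty /(congr1 val); rewrite /= !pK => pxy.
  by apply: (coresolving_twin connG coT); rewrite // -p_twin pxy.
rewrite leqNgt; apply/negP => ltT.
(* More than [D] vertices in distinct classes must meet every class. *)
have onT i : i <= D -> exists2 t, t \in T & p t = i.
  move=> iD; have : inord i \in [set q x | x in T].
    suff -> : [set q x | x in T] = setT by rewrite inE.
    by apply/eqP; rewrite eqEcard subsetT cardsT card_ord (card_in_imset inj_p).
  case/imsetP=> t Tt /(congr1 val) /=; rewrite pK inordK // => ->.
  by exists t.
have [ta Ta pa] := onT a (leq_trans (ltnW ab) bD); have [tb Tb pb] := onT b bD.
have tab : ta != tb by apply: contraTneq ab => tab; rewrite -pa -pb tab ltnn.
have [s sT] := coT ta tb Ta Tb tab.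
have [t Tt ptt] := onT (p s) (p_le s).
have Bs : q s \in big_classes.
  rewrite inE; apply/existsP; exists s; apply/existsP; exists t.
  by rewrite pK ptt !eqxx !andbT; apply: contraNneq sT => ->.
rewrite 2!(dist_sym connG _ s) !layout_class_dist; last 2 first.
- by apply: contraNneq sT => ->.
- by apply: contraNneq sT => ->.
by have := abP _ Bs; rewrite pK pa pb => ->; rewrite eqxx.
Qed.

End PathLayout.

Lemma val_u D j : j <= D -> (u D j : 'I_D.+1) = j :> nat.
Proof. by move=> jD; rewrite inordK. Qed.

Lemma eq_u D (j : 'I_D.+1) i : i <= D -> (j == u D i) = (j == i :> nat).
Proof. by move=> iD; rewrite -val_eqE /= val_u. Qed.

Lemma layout_blowup (G : sgraph) D (p : G -> nat) : path_layout D p ->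
  exists2 phi : G -> path_graph D, blowup phi & forall x, p x = (phi x : 'I_D.+1) :> nat.
Proof.
case=> p_le p_surj adj_p p_twin.
pose q x : 'I_D.+1 := inord (p x).
have qE x : q x = p x :> nat by rewrite inordK ?ltnS.
have eq_q x y : (q x == q y) = (p x == p y) by rewrite -!qE.
exists (q : G -> path_graph D) => //; split=> [h | x y | x y].
- have [x px] : exists x, p x = (h : 'I_D.+1) by apply: p_surj; rewrite -ltnS.
  by exists x; apply: val_inj; rewrite /= qE.
- by rewrite eq_q => /adj_p->; rewrite /= /path_adj !qE /gap; lia.
by rewrite -p_twin -eq_q.
Qed.

Lemma blowup_layout (G : sgraph) D (phi : G -> path_graph D) : blowup phi ->
  path_layout D (fun x => (phi x : 'I_D.+1) : nat).
Proof.
case=> phi_surj adj_phi phi_twin; split=> [x | i iD | x y xy | x y].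
- by rewrite -ltnS.
- by have [x px] := phi_surj (u D i); exists x; rewrite px inordK.
- by rewrite adj_phi //= /path_adj /gap; lia.
by rewrite -phi_twin.
Qed.

(** * Types, leaves and distances in a twin graph that is a path *)

Section TwinClassTypes.
Variables (G : sgraph) (D : nat) (p : G -> nat) (f : path_graph D -> twin_graph G).
Hypothesis connG : connected G.
Hypothesis layout_p : path_layout D p.
Hypothesis iso_f : is_iso f.
Hypothesis val_f : forall i : 'I_D.+1, val (f i) = [set x | p x == i].
Hypothesis D_ge3 : 3 <= D.
Implicit Types (i j : 'I_D.+1) (C : twin_graph G).

Let B := big_classes D p.
Let K := class_complete p.

Lemma card_class_gt1 i : (2 <= #|val (f i)|) = (i \in B).
Proof.
rewrite val_f inE; apply/card_gt1P/existsP => [[x [y [px py xy]]]|[x /existsP[y]]].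
  by exists x; apply/existsP; exists y; rewrite xy; move: px py; rewrite !inE => -> ->.
by case/and3P=> xy px py; exists x, y; rewrite !inE.
Qed.

Lemma card_class_gt0 i : 0 < #|val (f i)|.
Proof.
case: layout_p => _ p_surj _ _; have [x px] : exists x, p x = i.
  by apply: p_surj; rewrite -ltnS.
by rewrite val_f; apply/card_gt0P; exists x; rewrite inE px.
Qed.

Lemma type1_path i : type1 (f i) = (i \notin B).
Proof. by rewrite -card_class_gt1 /type1; have := card_class_gt0 i; lia. Qed.

Lemma typeK_path i : typeK (f i) = (i \in B) && K i.
Proof.
rewrite /typeK card_class_gt1; apply: andb_id2l; rewrite -card_class_gt1 => /card_gt1P.
case=> x [y [Cx Cy xy]]; have pE z : z \in val (f i) -> p z = i by rewrite val_f inE => /eqP.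
have [px py] := (pE x Cx, pE y Cy).
apply/forall_inP/idP => [allK | Ki v Cv].
  have /forall_inP/(_ y Cy) := allK x Cx; rewrite xy /= -px /K.
  by rewrite (class_completeE layout_p xy) ?px ?py.
apply/forall_inP => w Cw; apply/implyP => vw; have [pv pw] := (pE v Cv, pE w Cw).
by rewrite -(class_completeE layout_p) // ?pv ?pw.
Qed.

Lemma typeN_path i : typeN (f i) = (i \in B) && ~~ K i.
Proof.
rewrite /typeN card_class_gt1; apply: andb_id2l; rewrite -card_class_gt1 => /card_gt1P.
case=> x [y [Cx Cy xy]]; have pE z : z \in val (f i) -> p z = i by rewrite val_f inE => /eqP.
have [px py] := (pE x Cx, pE y Cy).
apply/forall_inP/idP => [allN | Ki v Cv].
  have /forall_inP/(_ y Cy) := allN x Cx; rewrite -px /K.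
  by rewrite (class_completeE layout_p xy) ?px ?py.
apply/forall_inP => w Cw; have [-> | vw] := eqVneq v w; first by rewrite adj_irr.
have [pv pw] := (pE v Cv, pE w Cw).
by rewrite -(class_completeE layout_p) // ?pv ?pw.
Qed.

Let inj_f : injective f. Proof. by case: iso_f => /bij_inj. Qed.

Let f_surj C : exists i : 'I_D.+1, C = f i.
Proof. by case: iso_f => -[f' _ f'K] _; exists (f' C); rewrite f'K. Qed.

Lemma alpha_path : alpha G = #|B|.
Proof.
have KN i : typeK (f i) || typeN (f i) = (i \in B).
  by rewrite typeK_path typeN_path -andb_orr orbN andbT.
rewrite /alpha -(card_imset _ inj_f); apply: eq_card => C; rewrite inE.
have [i ->] := f_surj C; rewrite KN; apply/idP/imsetP => [Bi|[j Bj /inj_f->//]].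
by exists i.
Qed.

Let adj_f i j : adj (f i) (f j) = (gap i j == 1).
Proof. by case: iso_f => _ ->; rewrite /= /path_adj /gap; lia. Qed.

Lemma leaf_path i : leaf (f i) = (i == 0 :> nat) || (i == D :> nat).
Proof.
rewrite /leaf /degree; have i_lt := ltn_ord i; set N := open_nbh _.
have inN j : (f j \in N) = (gap i j == 1) by rewrite inE adj_f.
have iD : i <= D by rewrite -ltnS.
case: (boolP (_ || _)) => [end_i | /norP[i0 iD']].
  pose j : 'I_D.+1 := inord (if i == 0 :> nat then 1 else i.-1).
  have jE : j = (if i == 0 :> nat then 1 else i.-1) :> nat.
    by rewrite inordK //; case: eqP; lia.
  suff -> : N = [set f j] by rewrite cards1.
  apply/setP => C; have [k ->] := f_surj C; rewrite inN inE (inj_eq inj_f) -val_eqE /= jE.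
  have k_lt := ltn_ord k; rewrite /gap; case: (eqVneq (i : nat) 0) end_i => /=; lia.
pose a : 'I_D.+1 := inord i.-1; pose b : 'I_D.+1 := inord i.+1.
have aE : a = i.-1 :> nat by rewrite inordK; lia.
have bE : b = i.+1 :> nat by rewrite inordK; lia.
suff : 1 < #|N| by case: (#|N|) => [|[]].
apply/card_gt1P; exists (f a), (f b); rewrite !inN (inj_eq inj_f) -val_eqE /= aE bE /gap.
by split; lia.
Qed.

Lemma dist_path i j : i != j -> (dist (f i) (f j) == 2) = (gap i j == 2).
Proof.
move=> ij; have ij' : i != j :> nat by [].
have fij : f i != f j by rewrite (inj_eq inj_f).
have [i_lt j_lt] := (ltn_ord i, ltn_ord j).
(* The default value of [dist] is the number of vertices; as this exceeds 2, a value at most 2 comes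
   from an actual walk. *)
have cardT : 3 < #|twin_graph G|.
  have cardP : #|path_graph D| = D.+1 := card_ord _.
  by apply: leq_trans (leq_card f inj_f); rewrite cardP.
apply/eqP/eqP => [dij | gij].
  have := walk_dist (x := f i) (y := f j); rewrite dij => /(_ (ltnW cardT)).
  rewrite walkS => /existsP[C]; have [k ->] := f_surj C; rewrite walk1 !adj_f.
  by move: ij'; rewrite /gap; lia.
pose k : 'I_D.+1 := inord ((i + j)./2).
have kE : k = ((i + j)./2) :> nat by rewrite inordK //; lia.
have w2 : walk (f i) (f j) 2.
  by rewrite walkS; apply/existsP; exists (f k); rewrite walk1 !adj_f kE; move: gij; rewrite /gap; lia.
have le2 := dist_le_walk w2; have := walk_dist (leq_ltn_trans le2 (ltnW cardT)).
case: (dist (f i) (f j)) le2 => [|[|[|//]]] _ //.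
  by rewrite walk0 (negPf fij).
by rewrite walk1 adj_f gij.
Qed.

Lemma path_types_cases :
  path_types B K <-> [\/ case1a G, case1b G, case1c G | case1d G].
Proof.
rewrite /path_types /case1a /case1b /case1c /case1d alpha_path.
have nt i : i \in B -> ~~ type1 (f i) by move=> Bi; rewrite type1_path negbK.
split=> [[] | []].
- by move=> B1; apply: Or41.
- case=> B2 BP; apply: Or42; split=> // C C'.
  have [i ->] := f_surj C; have [j ->] := f_surj C'; rewrite (inj_eq inj_f) !type1_path !negbK.
  move=> ij Bi Bj; have [gij KP] := BP i j Bi Bj ij; rewrite adj_f gij; split=> //.
  rewrite leaf_path !typeK_path Bj => ei /andP[_ Ki]; apply: KP => //.
  by case/orP: ei => /eqP; [left | right].
- case=> B2 BP; apply: Or43; split=> // C C'.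
  have [i ->] := f_surj C; have [j ->] := f_surj C'; rewrite (inj_eq inj_f) !type1_path !negbK.
  move=> ij Bi Bj; have [gij Ki Kj] := BP i j Bi Bj ij; rewrite !typeN_path Bi Bj.
  by split=> //; apply/eqP; rewrite dist_path // gij.
- case=> B3 [c [i [j [[Bc Bi Bj] ij ci cj [Ki Kj]]]]]; apply: Or44; split=> //.
  exists (f c), (f i), (f j); rewrite (inj_eq inj_f) !adj_f ci cj !typeN_path typeK_path.
  by rewrite Bc Bi Bj Ki Kj; split=> //; rewrite /= orNb.
- by move=> B1; apply: Or41.
- case=> B2 BP; apply: Or42; split=> // i j Bi Bj ij.
  have [] := BP (f i) (f j); rewrite ?(inj_eq inj_f) ?nt //.
  rewrite adj_f => /eqP gij KP; split=> // ei Ki.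
  have : typeK (f j).
    apply: KP; last by rewrite typeK_path Bi.
    by rewrite leaf_path; case: ei => ->; rewrite eqxx ?orbT.
  by rewrite typeK_path => /andP[].
- case=> B2 BP; apply: Or43; split=> // i j Bi Bj ij.
  have [] := BP (f i) (f j); rewrite ?(inj_eq inj_f) ?nt //.
  by move/eqP; rewrite dist_path // => /eqP gij; rewrite !typeN_path Bi Bj.
case=> B3 [C [A [A' [CNK AA' /andP[CA CA'] NA NA']]]]; apply: Or44; split=> //.
move: CNK AA' CA CA' NA NA'; have [c ->] := f_surj C; have [i ->] := f_surj A.
have [j ->] := f_surj A'; rewrite typeK_path !typeN_path (inj_eq inj_f) !adj_f.
move=> Kc ij /eqP ci /eqP cj /andP[Bi Ki] /andP[Bj Kj]; exists c, i, j.
by split=> //; split=> //; case/orP: Kc => /andP[].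
Qed.

End TwinClassTypes.

Lemma path_metric_dim (G : sgraph) D (p : G -> nat)
    (f : path_graph D -> twin_graph G) : connected G -> 3 <= D ->
    path_layout D p -> is_iso f ->
    (forall i : 'I_D.+1, val (f i) = [set x | p x == i]) ->
  (forall T : {set G}, coresolving T -> #|T| <= D) <->
  [\/ case1a G, case1b G, case1c G | case1d G].
Proof.
move=> connG D_ge3 layout_p iso_f val_f.
have D_gt0 : 0 < D by apply: leq_trans D_ge3.
apply: iff_trans (layout_max_coresolving connG layout_p D_gt0) _.
apply: iff_trans (path_types_cases layout_p iso_f val_f D_ge3); split.
  exact: unresolved_path_types.
exact: path_types_unresolved.
Qed.

(** * Twin graphs with three branches *)

Section Branches.
Variables (G H : sgraph) (phi : G -> H) (I : finType).
(** [leg i] is the vertex of branch [i] through which the branch is entered, and [branch] is [None]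
    at a centre, if there is one. The hypotheses say that a branch can be collapsed onto a vertex of
    another leg, that distinct vertices in legs, even in the same leg, are at the constant distance
    [e], and that only centre and legs can be big classes. *)
Variables (leg : I -> H) (branch : H -> option I) (e : nat).
Hypothesis connG : connected G.
Hypothesis blowup_phi : blowup phi.
Hypothesis I_gt2 : 2 < #|I|.
Hypothesis branch_leg : forall i, branch (leg i) = Some i.
Hypothesis exit_branch : forall i j x y t, i != j ->
  branch (phi x) != Some i -> branch (phi y) = Some i -> adj x y ->
  phi t = leg j -> x = t \/ adj x t.
Hypothesis dist_legs : forall i j x y, x != y ->
  phi x = leg i -> phi y = leg j -> dist x y = e.
Hypothesis big_class : forall x y, x != y -> phi x = phi y ->
  branch (phi x) = None \/ exists i, phi x = leg i.

Lemma dist_branch i j s x y : i != j -> branch (phi s) != Some i ->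
  phi x = leg i -> phi y = leg j -> dist s y <= dist s x.
Proof.
move=> ij si xi yj.
apply: (@dist_retract _ connG [set v | branch (phi v) == Some i]).
- by rewrite inE.
- by rewrite inE xi branch_leg eqxx.
by move=> v w; rewrite !inE => vi /eqP wi vw; apply: exit_branch wi vw yj.
Qed.

(* A coresolving set missing at most one class meets two legs outside the
   branch of that class, and nothing separates its vertices in these legs. *)
Lemma coresolving_branches (T : {set G}) : coresolving T -> #|T| < #|H|.-1.
Proof.
move=> coT; rewrite ltnNge; apply/negP => leT.
have [phi_surj _ phi_twin] := blowup_phi.
have inj_phi : {in T &, injective phi}.
  by move=> x y Tx Ty /eqP; rewrite phi_twin; apply: (coresolving_twin connG coT).
(* [X] is the class that [T] misses, and arbitrary if there is none. *)
have [X XP] : exists X, forall h, h != X -> h \in phi @: T.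
  have coC : #|~: (phi @: T)| <= 1.
    by have := cardsC (phi @: T); rewrite (card_in_imset inj_phi); lia.
  have [C0 | [X CX]] := set_0Vmem (~: (phi @: T)).
    have [i _] : exists i : I, i \in I by apply/card_gt0P; apply: leq_trans I_gt2.
    by exists (leg i) => h _; apply: contraT => hT; rewrite -(in_set0 h) -C0 inE hT.
  exists X => h; apply: contraR => hT; apply/eqP.
  by move/card_le1_eqP: coC; apply; rewrite // inE.
have [i [j [ij Xi Xj]]] : exists i j, [/\ i != j, branch X != Some i & branch X != Some j].
  have : 1 < #|~: [set i | branch X == Some i]|.
    have : #|[set i | branch X == Some i]| <= 1.
      by apply/card_le1_eqP => i j; rewrite !inE => /eqP -> /eqP[].
    by have := cardsC [set i | branch X == Some i]; lia.
  by case/card_gt1P => i [j [/[!inE] Xi Xj ij]]; exists i, j.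
have legT k : branch X != Some k -> exists2 t, t \in T & phi t = leg k.
  move=> Xk; have /imsetP[t Tt tk] : leg k \in phi @: T.
    by apply: XP; apply: contraNneq Xk => <-; rewrite branch_leg.
  by exists t.
have [ti Ti phi_i] := legT i Xi; have [tj Tj phi_j] := legT j Xj.
have tij : ti != tj.
  apply: contraNneq ij => tij; have /Some_inj-> : Some i = Some j; last exact: eqxx.
  by rewrite -!branch_leg -phi_i -phi_j tij.
have [s sT] := coT ti tj Ti Tj tij; rewrite 2!(dist_sym connG _ s).
have far : branch (phi s) != Some i -> branch (phi s) != Some j ->
    dist s ti = dist s tj.
  move=> si sj; apply/eqP; rewrite eqn_leq (dist_branch ij si phi_i phi_j).
  by rewrite eq_sym in ij; rewrite (dist_branch ij sj phi_j phi_i).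
(* The class of [s] is either the missed one, outside both branches, or it also contains a vertex of
   [T]; it is then big, hence the centre or a leg. *)
have [sX | sX] := eqVneq (phi s) X; first by rewrite far ?sX // eqxx.
have /imsetP[t Tt st] := XP _ sX.
have s_neq v : v \in T -> s != v by move=> Tv; apply: contraNneq sT => ->.
have [sN | [l sl]] := big_class (s_neq t Tt) st; first by rewrite far ?sN // eqxx.
by rewrite !(dist_legs _ sl phi_i, dist_legs _ sl phi_j) ?s_neq ?eqxx.
Qed.

End Branches.

Section ClassTypes.
Variables (G H : sgraph) (phi : G -> H) (f : H -> twin_graph G).
Hypothesis val_f : forall h, val (f h) = [set x | phi x == h].
Hypothesis phi_surj : forall h, exists x, phi x = h.

Let mem_f x h : (x \in val (f h)) = (phi x == h). Proof. by rewrite val_f inE. Qed.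

Lemma card_fiber_gt0 h : 0 < #|val (f h)|.
Proof. by have [x xh] := phi_surj h; apply/card_gt0P; exists x; rewrite mem_f xh. Qed.

Lemma type1_fiber h : reflect (forall x y, phi x = h -> phi y = h -> x = y) (type1 (f h)).
Proof.
have gt0 := card_fiber_gt0 h; apply: (iffP idP) => [/eqP h1 x y xh yh | h1].
  have /card_le1_eqP : #|val (f h)| <= 1 by rewrite h1.
  by apply; rewrite mem_f ?xh ?yh.
rewrite /type1 eqn_leq gt0 andbT; apply/card_le1_eqP => x y; rewrite !mem_f.
by move=> /eqP xh /eqP yh; apply: h1.
Qed.

Lemma type1K_fiber h :
  reflect (forall x y, x != y -> phi x = h -> phi y = h -> adj x y) (type1K (f h)).
Proof.
apply: (iffP orP) => [[/type1_fiber h1 | /andP[_ /forall_inP allK]] x y xy xh yh | allK].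
- by rewrite (h1 x y) ?eqxx in xy.
- have /forall_inP/(_ y) : [forall w in val (f h), (x != w) ==> adj x w].
    by apply: allK; rewrite mem_f xh.
  by rewrite mem_f yh eqxx xy; apply.
have [h1 | h1] := boolP (type1 (f h)); [by left | right].
rewrite /typeK; have := card_fiber_gt0 h; move: h1; rewrite /type1 => h1 h0.
have -> /= : 1 < #|val (f h)| by lia.
apply/forall_inP => x; rewrite mem_f => /eqP xh; apply/forall_inP => y.
by rewrite mem_f => /eqP yh; apply/implyP => xy; apply: allK.
Qed.

Lemma type1N_fiber h :
  reflect (forall x y, phi x = h -> phi y = h -> ~~ adj x y) (type1N (f h)).
Proof.
apply: (iffP orP) => [[/type1_fiber h1 | /andP[_ /forall_inP allN]] x y xh yh | allN].
- by rewrite (h1 x y) // adj_irr.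
- have /forall_inP/(_ y) : [forall w in val (f h), ~~ adj x w].
    by apply: allN; rewrite mem_f xh.
  by rewrite mem_f yh eqxx; apply.
have [h1 | h1] := boolP (type1 (f h)); [by left | right].
rewrite /typeN; have := card_fiber_gt0 h; move: h1; rewrite /type1 => h1 h0.
have -> /= : 1 < #|val (f h)| by lia.
apply/forall_inP => x; rewrite mem_f => /eqP xh; apply/forall_inP => y.
by rewrite mem_f => /eqP yh; apply: allN.
Qed.

End ClassTypes.

Lemma card_add_vertex D (A : {set path_graph D}) : #|add_vertex A| = D.+2.
Proof. by rewrite [LHS]card_option card_ord. Qed.

(** The centre is the degree-3 vertex and the legs are its neighbours. Their types (1N) put any two
    vertices in legs at distance 2. *)
Lemma case2_max_coresolving (G : sgraph) D : connected G -> case2 G D ->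
  forall T : {set G}, coresolving T -> #|T| <= D.
Proof.
move=> connG [k /andP[k_ge3 kD] [f iso_f [typesN types1]]] T coT.
have [phi blowup_phi val_f] := iso_blowup iso_f.
have [phi_surj adj_phi phi_twin] := blowup_phi; have [[f' fK f'K] adj_f] := iso_f.
pose leg (i : option bool) : path_pendant D k :=
  match i with None => None | Some true => Some (u D k) | Some false => Some (u D k.-2) end.
pose branch (h : path_pendant D k) : option (option bool) :=
  match h with
  | None => Some None
  | Some j => if (j : 'I_D.+1) == k.-1 :> nat then None
              else Some (Some (k <= (j : 'I_D.+1)))
  end.
have branch_leg i : branch (leg i) = Some i.
  case: i => [[]|] //=; rewrite val_u; try lia.
    by case: eqP => [|_]; [lia | rewrite leqnn].
  by case: eqP => [|_]; [lia | congr (Some (Some _)); lia].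
have adj_c i : adj (Some (u D k.-1) : path_pendant D k) (leg i).
  case: i => [[]|] /=; rewrite ?inE ?eqxx // /path_adj !val_u; lia.
have c_branch h : branch h = None -> h = Some (u D k.-1).
  case: h => //= j; case: eqP => // jk _; congr Some; apply: val_inj => /=.
  by rewrite val_u //; lia.
have exit_branch i (h h' : path_pendant D k) : branch h != Some i ->
    branch h' = Some i -> adj h h' -> branch h = None.
  case: h => [j|]; case: h' => [j'|] //=; rewrite ?inE.
  - case: ((j : 'I_D.+1) =P k.-1 :> nat) => // jk.
    case: ((j' : 'I_D.+1) =P k.-1 :> nat) => // jk' ji [ii]; rewrite -ii in ji => {ii}.
    rewrite /path_adj => jj'; case/negP: ji; apply/eqP; congr (Some (Some _)); lia.
  - by move=> _ _ /eqP->; rewrite val_u ?eqxx //; lia.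
  - by move=> _ ji /eqP jk; move: ji; rewrite jk val_u ?eqxx //; lia.
have leg_type i : type1N (f (leg i)) by apply: typesN; rewrite adj_f adj_c.
suff : #|T| < #|path_pendant D k|.-1 by rewrite card_add_vertex.
apply: (coresolving_branches connG blowup_phi (leg := leg) (branch := branch) (e := 2)) => //.
- by rewrite card_option card_bool.
- move=> i j x y t ij xi yi xy tj; right.
  have xc : phi x = Some (u D k.-1).
    apply/c_branch/(exit_branch i _ (phi y)) => //; rewrite -adj_phi //.
    by apply: contraNneq xi => ->; rewrite yi.
  by rewrite adj_phi ?xc ?tj ?adj_c //; apply: contraTneq (adj_c j) => <-; rewrite adj_irr.
- move=> i j x y xy xi yj; have [c phi_c] := phi_surj (Some (u D k.-1)).
  have adj_cx l v : phi v = leg l -> adj c v.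
    move=> vl; rewrite adj_phi phi_c ?vl ?adj_c //.
    by apply: contraTneq (adj_c l) => <-; rewrite adj_irr.
  apply: (@dist_eq2 _ connG _ _ c) => //; last 2 first.
  + by rewrite adj_sym (adj_cx i).
  + exact: adj_cx yj.
  have [ij | ij] := eqVneq i j.
    by move/(type1N_fiber val_f phi_surj): (leg_type i); apply; rewrite // yj ij.
  have leg_ij : leg i != leg j.
    by apply: contraNneq ij => /(congr1 branch); rewrite !branch_leg => -[->].
  rewrite adj_phi xi yj //; apply: contraNN ij => ij.
  apply: contraT => ij'; have := exit_branch i (leg j) (leg i).
  rewrite !branch_leg adj_sym ij => H; suff: Some j = None by [].
  by apply: H => //; apply: contra ij' => /eqP/Some_inj->.
move=> x y xy pxy; have [c1 | c1] := boolP (type1 (f (phi x))).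
  by move/(type1_fiber val_f phi_surj): c1 => c1; rewrite (c1 x y) ?eqxx in xy.
have [pc | pc] := eqVneq (phi x) (Some (u D k.-1)).
  by left; rewrite pc /= val_u ?eqxx //; lia.
right; have : adj (f (Some (u D k.-1))) (f (phi x)).
  by apply: contraNT c1 => c1; apply: types1; rewrite // (inj_eq (can_inj fK)).
rewrite adj_f; case: (phi x) pc => [j|] pc; last by exists None.
rewrite /= /path_adj val_u => [jk|]; last lia.
have [kj | kj] := leqP k (j : 'I_D.+1).
  by exists (Some true); congr Some; apply: val_inj => /=; rewrite val_u; lia.
by exists (Some false); congr Some; apply: val_inj => /=; rewrite val_u; lia.
Qed.

(** There is no centre: deleting the edges of the triangle leaves three branches, whose legs are the
    vertices of the cycle. Types (1K) make distinct vertices in legs adjacent. *)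
Lemma case3_max_coresolving (G : sgraph) D : connected G -> case3 G D ->
  forall T : {set G}, coresolving T -> #|T| <= D.
Proof.
move=> connG [k /andP[k_ge2 kD] [f iso_f types]] T coT.
have [phi blowup_phi val_f] := iso_blowup iso_f.
have [phi_surj adj_phi phi_twin] := blowup_phi; have [[f' fK f'K] adj_f] := iso_f.
pose leg (i : option bool) : path_triangle D k :=
  match i with None => None | Some true => Some (u D k) | Some false => Some (u D k.-1) end.
pose branch (h : path_triangle D k) : option (option bool) :=
  Some (if h is Some j then Some (k <= (j : 'I_D.+1)) else None).
have branch_leg i : branch (leg i) = Some i.
  by case: i => [[]|] //; rewrite /branch /= val_u; try lia; do 2!congr Some; lia.
have u_neq : u D k != u D k.-1 by rewrite -val_eqE /= !val_u; lia.
have adj_legs i j : i != j -> adj (leg i) (leg j).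
  by case: i => [[]|]; case: j => [[]|] //= _; rewrite ?inE ?eqxx ?orbT // /path_adj !val_u; lia.
have exit_branch i (h h' : path_triangle D k) : branch h != Some i ->
    branch h' = Some i -> adj h h' -> exists j, h = leg j.
  case: h => [j|]; case: h' => [j'|] //=; rewrite ?inE; last by exists None.
  - move=> ji [ii]; rewrite -ii in ji => {ii}; rewrite /path_adj => jj'.
    have {}ji : (k <= (j : 'I_D.+1)) != (k <= (j' : 'I_D.+1)).
      by apply: contra ji => /eqP kj; rewrite /branch kj.
    have [kj | kj] := leqP k (j : 'I_D.+1).
      by exists (Some true); congr Some; apply: val_inj => /=; rewrite val_u; lia.
    by exists (Some false); congr Some; apply: val_inj => /=; rewrite val_u; lia.
  by move=> _ _ /orP[] /eqP->; [exists (Some false) | exists (Some true)].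
have leg_adj i j x y : x != y -> phi x = leg i -> phi y = leg j -> adj x y.
  move=> xy xi yj; have [ij | ij] := eqVneq i j; last first.
    rewrite adj_phi xi yj ?adj_legs //.
    by apply: contraNneq ij => /(congr1 branch); rewrite !branch_leg => -[->].
  have := types (f (leg i)); case: ifP => [_ /(type1K_fiber val_f phi_surj)|].
    by apply; rewrite // yj ij.
  by case: (i) => [[]|]; rewrite !inE eqxx ?orbT.
suff : #|T| < #|path_triangle D k|.-1 by rewrite card_add_vertex.
apply: (coresolving_branches connG blowup_phi (leg := leg) (branch := branch) (e := 1)) => //.
- by rewrite card_option card_bool.
- move=> i j x y t ij xi yi xy tj; have [-> | xt] := eqVneq x t; [by left | right].
  have [l xl] : exists l, phi x = leg l.
    apply: (exit_branch i _ (phi y)) => //; rewrite -adj_phi //.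
    by apply: contraNneq xi => ->; rewrite yi.
  exact: leg_adj xl tj.
- by move=> i j x y xy xi yj; apply: dist_adj; last exact: leg_adj xi yj.
move=> x y xy pxy; right; have := types (f (phi x)); case: ifP => [|_]; last first.
  by move/(type1_fiber val_f phi_surj)=> c1; rewrite (c1 x y) ?eqxx in xy.
rewrite !inE !(inj_eq (can_inj fK)) => /orP[/orP[]|] /eqP-> _.
- by exists None.
- by exists (Some false).
by exists (Some true).
Qed.

(** * Structure of the extremal graphs *)

Definition twin_free (H : sgraph) :=
  forall h h' : H, h != h' ->
  exists z, [/\ z != h, z != h' & adj z h != adj z h'].

(** Twins of [G] with distinct images would have twins as images. It is therefore enough that each
    fibre lies inside a twin class. *)
Lemma twin_free_blowup (G H : sgraph) (phi : G -> H) : twin_free H ->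
    (forall h, exists x, phi x = h) ->
    (forall x y, phi x != phi y -> adj x y = adj (phi x) (phi y)) ->
    (forall x y, phi x = phi y -> y \in twin_class x) ->
  blowup phi.
Proof.
move=> freeH phi_surj adj_phi phi_twin; split=> // x y.
apply/eqP/idP => [|xy]; first exact: phi_twin.
apply/eqP; apply: contraT => /[dup] pxy /freeH[h [hx hy]].
have [z zh] := phi_surj h; rewrite -zh in hx hy *.
rewrite -!adj_phi // (twin_adjP xy) ?eqxx //.
  by apply: contraNneq hx => ->.
by apply: contraNneq hy => ->.
Qed.

Lemma path_twin_free D : 3 <= D -> twin_free (path_graph D).
Proof.
move=> D_ge3 i j; wlog lt_ij : i j / (i : 'I_D.+1) < (j : 'I_D.+1) => [IH ij | _].
  have ij' : (i : 'I_D.+1) != j :> nat by [].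
  case: (ltnP (i : 'I_D.+1) (j : 'I_D.+1)) => [lt_ij | le_ji]; first exact: IH.
  rewrite eq_sym in ij; case: (IH j i _ ij); first lia.
  by move=> z [zj zi zij]; exists z; split; rewrite // eq_sym.
have j_lt := ltn_ord (j : 'I_D.+1).
(* The witness is the outer neighbour of [i] or of [j]. For the two ends of the path it is the inner
   neighbour of [j], which is not adjacent to [i] because [D >= 3]. *)
pose k := if 0 < (i : 'I_D.+1) then (i : 'I_D.+1).-1 else
          if (j : 'I_D.+1) < D then (j : 'I_D.+1).+1 else (j : 'I_D.+1).-1.
have kE : (u D k : 'I_D.+1) = k :> nat.
  by rewrite inordK // /k; case: ifP => ?; [|case: ifP => ?]; lia.
exists (u D k); rewrite -!val_eqE /= /path_adj kE /k.
case: ifP => i0; last case: ifP => jD; split; lia.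
Qed.

Lemma add_vertex_twin_free (G : sgraph) (A : {set G}) : twin_free G ->
    (forall v, exists z, z != v /\ (z \in A) != adj z v) ->
  twin_free (add_vertex A).
Proof.
move=> freeG freeA; have freeN v :
    exists z : add_vertex A, [/\ z != None, z != Some v & adj z None != adj z (Some v)].
  by have [z [zv zA]] := freeA v; exists (Some z).
case=> [v|] [w|] //= vw.
- have [z [zv zw zvw]] := freeG v w vw; by exists (Some z).
- by have [z [z1 z2 z3]] := freeN v; exists z; split; rewrite // eq_sym.
Qed.

Lemma path_pendant_twin_free D k : 3 <= k <= D.-1 -> twin_free (path_pendant D k).
Proof.
move=> kD; apply: add_vertex_twin_free => [|v]; first by apply: path_twin_free; lia.
(* For [v] at or next to the attachment vertex, a path neighbour of [v] other than that vertex; the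
   bounds on [k] keep it on the path. Otherwise the attachment vertex itself works. *)
pose i := if (v : 'I_D.+1) == k.-1 :> nat then k.-2 else
          if (v : 'I_D.+1) == k.-2 :> nat then k - 3 else
          if (v : 'I_D.+1) == k :> nat then k.+1 else k.-1.
have iE : (u D i : 'I_D.+1) = i :> nat.
  by rewrite val_u // /i; do 3?[case: ifP => ?]; lia.
exists (u D i); rewrite inE -!val_eqE /= /path_adj (@val_u D k.-1) ?iE; last lia.
by rewrite /i; do 3?[case: ifP => ?]; split; lia.
Qed.

Lemma path_triangle_twin_free D k : 3 <= D -> 2 <= k <= D.-1 ->
  twin_free (path_triangle D k).
Proof.
move=> D_ge3 kD; apply: add_vertex_twin_free => [|v]; first exact: path_twin_free.
have v_lt := ltn_ord (v : 'I_D.+1).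
pose i := if (v : 'I_D.+1) == k.-1 :> nat then k.-2 else
          if (v : 'I_D.+1) == k :> nat then k.+1 else
          if (v : 'I_D.+1) < k then k else k.-1.
have iE : (u D i : 'I_D.+1) = i :> nat.
  by rewrite val_u // /i; do 3?[case: ifP => ?]; lia.
exists (u D i); rewrite !inE -!val_eqE /= /path_adj (@val_u D k.-1) ?(@val_u D k) ?iE; try lia.
by rewrite /i; do 3?[case: ifP => ?]; split; lia.
Qed.

Lemma twin_free_layout (G : sgraph) D (p : G -> nat) : 3 <= D ->
    (forall x, p x <= D) -> (forall i, i <= D -> exists x, p x = i) ->
    (forall x y, p x != p y -> adj x y = (gap (p x) (p y) == 1)) ->
    (forall x y, p x = p y -> y \in twin_class x) ->
  path_layout D p.
Proof.
move=> D_ge3 p_le p_surj adj_p p_twin; pose q x : path_graph D := u D (p x).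
have qE x : (q x : 'I_D.+1) = p x :> nat by rewrite val_u.
have eq_q x y : (q x == q y) = (p x == p y) by rewrite -!qE.
suff [_ _ q_twin] : blowup q by split=> // x y; rewrite -eq_q.
apply: twin_free_blowup => [|h|x y|x y].
- exact: path_twin_free.
- have [x px] : exists x, p x = (h : 'I_D.+1) by apply: p_surj; rewrite -ltnS.
  by exists x; apply: val_inj; rewrite /= qE.
- by rewrite eq_q => /adj_p->; rewrite /= /path_adj !qE /gap; lia.
by move/eqP; rewrite eq_q => /eqP/p_twin.
Qed.

Section Structure.
Variables (G : sgraph) (D : nat) (r : G).
Hypothesis connG : connected G.
Hypothesis D_ge3 : 3 <= D.
Hypothesis dist_le : forall x y : G, dist x y <= D.
Hypothesis dist_r_max : exists w, dist r w = D.
Hypothesis maxT : forall T : {set G}, coresolving T -> #|T| <= D.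
Implicit Types (v w : G).

Lemma layer_up v : 0 < dist r v -> exists2 w, adj v w & (dist r w).+1 = dist r v.
Proof.
move=> rv; have [w vw wr] : exists2 w, adj v w & dist w r = (dist r v).-1.
  by apply: (dist_step connG); rewrite dist_sym //; lia.
by exists w; rewrite // dist_sym // wr; lia.
Qed.

Lemma layer_adj_le v w : adj v w -> dist r w <= (dist r v).+1.
Proof. exact: dist_adj_le. Qed.

Lemma twin_layer_adj v v' w : v' \in twin_class v -> dist r v' = dist r v ->
  dist r w != dist r v -> adj v w = adj v' w.
Proof.
move=> vv' rvv' rwv; rewrite ![adj _ w]adj_sym; apply: twin_adjP vv' _ _.
  by apply: contraNneq rwv => ->.
by apply: contraNneq rwv => ->; rewrite rvv'.
Qed.

(** A vertex has a neighbour in the preceding layer, and being twins, all vertices of that layer are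
    then its neighbours. *)
Lemma one_class_layers : (forall v w, dist r v = dist r w -> w \in twin_class v) ->
  path_layout D (dist r).
Proof.
move=> layer1; apply: twin_free_layout => // [i|v w].
  exact: (layer_nonempty connG dist_r_max).
wlog lt_vw : v w / dist r v < dist r w => [IH vw | _].
  case: (ltnP (dist r v) (dist r w)) => [lt | le]; first exact: IH lt vw.
  by rewrite adj_sym IH /gap 1?addnC //; lia.
have [z wz rz] : exists2 z, adj w z & (dist r z).+1 = dist r w by apply: layer_up; lia.
apply/idP/eqP => [/layer_adj_le | gvw]; first by rewrite /gap; lia.
have rzv : dist r z = dist r v by move: gvw; rewrite /gap; lia.
by rewrite -(twin_layer_adj (layer1 _ _ rzv)) 1?adj_sym // ?rzv //; lia.
Qed.

(** * A layer with two twin classes *)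

Section TwoClassLayer.
Variables (x y z : G) (m : nat).
Hypothesis rx : dist r x = m.
Hypothesis ry : dist r y = m.
Hypothesis xy_nontwin : y \notin twin_class x.
Hypothesis rz : dist r z = m.+1.
Hypothesis z_uniq : forall w, dist r w = dist r z -> w = z.
Hypothesis zx : adj z x.
Hypothesis zy : ~~ adj z y.

(** The class of [y] in layer [m]: its vertices have no neighbour in the next layer. By homogeneity,
    [full] tells whether layer [m] is complete or empty. *)
Let lower v := (dist r v == m) && ~~ adj z v.
Let full := adj x y.

Ltac nat_lia :=
  repeat match goal with
  | H : ?T |- _ => lazymatch T with
    | nat => fail
    | @eq nat _ _ => fail
    | is_true (leq _ _) => fail
    | is_true (@eq_op ?E _ _) => first [unify (Equality.sort E) nat; fail 1 | clear H]
    | is_true (~~ @eq_op ?E _ _) => first [unify (Equality.sort E) nat; fail 1 | clear H]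
    | _ => clear H
    end
  end; lia.

Let rxy : dist r x = dist r y. Proof. by rewrite rx ry. Qed.
Let xy : x != y.
Proof. by apply: contraNneq xy_nontwin => ->; apply: twin_class_refl. Qed.
Let lower_y : lower y. Proof. by rewrite /lower ry eqxx. Qed.
Let lower_x : ~~ lower x. Proof. by rewrite /lower zx andbF. Qed.

Let m_gt0 : 0 < m.
Proof.
rewrite -rx dist_gt0 //; apply: contraNneq xy => r_x.
by rewrite -(dist_eq0 connG) -{1}r_x -rxy -r_x distxx.
Qed.

Let m_lt : m < D. Proof. by rewrite -rz. Qed.

Let above v w : m < dist r v -> dist r w = dist r v -> w = v.
Proof. by rewrite -rx; apply: (nontwin_above connG dist_r_max maxT rxy xy_nontwin). Qed.

Let layer_m_twins v w : dist r v = m -> dist r w = m -> lower v = lower w ->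
  w \in twin_class v.
Proof.
move=> rv rw; rewrite /lower rv rw eqxx /= => /negb_inj vw.
have rzx : dist r z = (dist r x).+1 by rewrite rx.
by apply: (layer_twins connG dist_r_max maxT rzx z_uniq); rewrite ?rx.
Qed.

(** Non-twins in an earlier layer would make layer [m] a singleton by [nontwin_above], but it
    contains [x] and [y]. *)
Let below v w : dist r v < m -> dist r v = dist r w -> w \in twin_class v.
Proof.
move=> rv rvw; apply: contraT => vw.
rewrite -rx in rv.
have yx := nontwin_above connG dist_r_max maxT rvw vw rv (esym rxy).
by move: xy; rewrite yx eqxx.
Qed.

Let lower_layer v : lower v -> dist r v = m. Proof. by case/andP=> /eqP. Qed.

Let layer_m_adj v w : v != w -> dist r v = m -> dist r w = m -> adj v w = full.
Proof. by move=> vw rv rw; apply: (layer_homogeneous connG dist_r_max maxT (x := x)); rewrite ?rx. Qed.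

Let adj_next v w : dist r w = (dist r v).+1 -> adj v w = ~~ lower v.
Proof.
move=> rvw; have [lt_v | lt_v | eq_v] := ltngtP (dist r v) m.
- have -> : ~~ lower v by rewrite /lower negb_and neq_ltn lt_v.
  have [v' wv' rv'] : exists2 v', adj w v' & (dist r v').+1 = dist r w by apply: layer_up; nat_lia.
  have rvv' : dist r v' = dist r v by nat_lia.
  by rewrite (twin_layer_adj (below lt_v (esym rvv'))) 1?adj_sym //; nat_lia.
- have -> : ~~ lower v by rewrite /lower negb_and neq_ltn lt_v orbT.
  have [v' wv' rv'] : exists2 v', adj w v' & (dist r v').+1 = dist r w by apply: layer_up; nat_lia.
  by rewrite adj_sym -(above lt_v (w := v')) //; nat_lia.
rewrite /lower eq_v eqxx negbK /= adj_sym; congr adj; apply: z_uniq.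
by rewrite rvw eq_v rz.
Qed.

Let not_adj_far v w : (dist r v).+1 < dist r w -> adj v w = false.
Proof. by move=> vw; apply/negP => /layer_adj_le; nat_lia. Qed.

(** A vertex that is not lower always has a neighbour that is not lower in the next layer, so it
    lies on a shortest path from [r] to [t]. *)
Lemma dist_far_end t v : dist r t = D -> ~~ lower v -> dist t v = D - dist r v.
Proof.
move=> rt; suff le_n n v' : ~~ lower v' -> dist r v' + n = D -> dist v' t <= n.
  move=> lv; have := le_n (D - dist r v) v lv (subnKC (dist_le r v)).
  by have := dist_trans connG r v t; rewrite rt (dist_sym connG t); nat_lia.
elim: n v' => [|n IHn] v' lv rv.
  by rewrite (@above t v') ?distxx // rt; nat_lia.
have [w [rw lw]] : exists w, dist r w = (dist r v').+1 /\ ~~ lower w.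
  have [vm | vm] := eqVneq (dist r v').+1 m; first by exists x; rewrite vm.
  have [w rw] : exists w, dist r w = (dist r v').+1.
    by apply: (layer_nonempty connG dist_r_max); nat_lia.
  by exists w; rewrite /lower rw (negPf vm).
have vw : adj v' w by rewrite adj_next.
have := IHn w lw; have := dist_trans connG v' w t; rewrite (dist_adj connG vw); nat_lia.
Qed.

(** A lower vertex cannot step towards [t]. It steps sideways to [x] if the layer is complete, and
    otherwise has to step back one layer first, which costs 2. *)
Lemma dist_far_end_lower t v : dist r t = D -> lower v ->
  dist t v = D - m + (if full then 1 else 2).
Proof.
move=> rt lv; have rv := lower_layer lv; have dist_t := dist_far_end rt.
have le_r w : D - dist r w <= dist t w.
  by have := dist_trans connG r w t; rewrite rt (dist_sym connG w t); nat_lia.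
have [l vl] : exists l, dist v t = l.+1.
  by exists (dist v t).-1; have := le_r v; rewrite (dist_sym connG v t); nat_lia.
have [w vw wl] := dist_step connG vl; have wv := vw; rewrite adj_sym in wv.
have vx : v != x by apply: contraNneq lower_x => <-.
have le_w := layer_adj_le vw; have le_w' := layer_adj_le wv.
have w_up : dist r w != (dist r v).+1.
  by apply/negP => /eqP /adj_next; rewrite vw lv.
have wD : dist t w = l by rewrite dist_sym.
have vD : dist t v = l.+1 by rewrite dist_sym.
have le_v u' : adj v u' -> dist t v <= (dist t u').+1.
  by rewrite adj_sym; apply: dist_adj_le.
case: ifP => [full1 | full0].
  have xv : adj v x by rewrite layer_m_adj.
  have := le_v x xv; rewrite (dist_t x) //; have := le_r w; rewrite rx.
  by move: w_up le_w le_w'; nat_lia.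
have rw : dist r w != m.
  apply: contraFneq full0 => rw; rewrite -(layer_m_adj _ rv rw) //.
  by apply: contraTneq vw => ->; rewrite adj_irr.
have lw : ~~ lower w by rewrite /lower (negPf rw).
by move: (dist_t w lw) w_up rw le_w le_w'; nat_lia.
Qed.

(** A neighbour of [w] one layer closer to [r] is at least two layers away from [v]. *)
Lemma lower_nontwin v w : lower v -> dist r w < m ->
    (if full then 1 else 2) = m - dist r w -> 0 < dist r w ->
  v \notin twin_class w.
Proof.
move=> lv rw fw w_gt0; have rv := lower_layer lv.
have [w' ww' rw'] := layer_up w_gt0.
apply/negP => wv; have : adj w' v = false by apply: not_adj_far; nat_lia.
rewrite -(twin_adjP wv); first by rewrite adj_sym ww'.
- by apply: contraTneq ww' => ->; rewrite adj_irr.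
by apply/eqP => w'v; move: rw'; rewrite w'v; nat_lia.
Qed.

(* Seen from the far end, the lower part of layer [m] shares its layer with
   layer [j], so the layers before [j] are singletons. *)
Lemma below_singletons j : 0 < j -> j + (if full then 1 else 2) = m ->
  (forall v w, dist r v < j -> dist r v = dist r w -> v = w) /\
  (forall v w, dist r v = j -> dist r w = j -> v != w -> adj v w = full).
Proof.
move=> j_gt0 jm; have [t rt] := dist_r_max; have dist_t := dist_far_end rt.
have j_lt : j < m by move: jm; case: ifP; nat_lia.
have below_lower v : dist r v < m -> ~~ lower v.
  by move=> rv; rewrite /lower negb_and neq_ltn rv.
have ty : dist t y = D - j by rewrite (dist_far_end_lower rt) //; nat_lia.
(* The two ends are exchanged: the results on layers are applied from [t], with [r] as far end. *)
have t_max : exists w, dist t w = D.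
  by exists r; rewrite dist_sym.
have tj v : dist r v = j -> dist t v = dist t y.
  by move=> rv; rewrite ty dist_t ?rv // below_lower ?rv.
have adj_y v : dist r v = j -> adj v y = full.
  move=> rv; move: jm; case: ifP => full1 jm.
    by rewrite adj_next ?below_lower ?rv ?ry //; nat_lia.
  by apply: not_adj_far; rewrite rv ry; nat_lia.
split=> [v w rv rvw | v w rv rw vw].
  have [a ra] : exists a, dist r a = j.
    by apply: (layer_nonempty connG dist_r_max); nat_lia.
  have ay : y \notin twin_class a by apply: lower_nontwin; rewrite ?ra //; nat_lia.
  apply: (nontwin_above connG t_max maxT (tj a ra) ay).
    by rewrite tj // ty dist_t ?below_lower; nat_lia.
  by rewrite !dist_t ?below_lower -?rvw; nat_lia.
(* Seen from [t], layer [j] and [y] share a homogeneous layer, so adjacency to [y] decides all of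
   it. *)
rewrite -(adj_y v rv); apply: (layer_homogeneous connG t_max maxT (x := y)) => //.
- exact: tj.
- exact: tj.
- exact: tj.
by apply: contraTneq j_lt => vy; rewrite -rv vy ry ltnn.
Qed.

(** In an empty layer [m], [y] is at distance [D - m + 2] from the far end, and this is at most
    [D]. *)
Lemma two_class_layer_bound : full || (1 < m).
Proof.
case: (boolP full) => //= full0; have [t rt] := dist_r_max.
have := dist_far_end_lower rt lower_y; have := dist_le t y.
rewrite (negPf full0); nat_lia.
Qed.

(** At these values of [m] the lower vertices are twins of [r], adjacent ones if [m = 1] and
    non-adjacent ones if [m = 2]; hence they get position 0. *)
Lemma short_path_layout : m = (if full then 1 else 2) ->
  path_layout D (fun v => if lower v then 0 else dist r v).
Proof.
move=> m_full; pose p v := if lower v then 0 else dist r v.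
have m_le2 : m <= 2 by rewrite m_full; case: ifP.
have adj_lower v w : lower v -> ~~ lower w -> 0 < dist r w ->
    adj v w = (dist r w == 1).
  move=> lv lw w_gt0; have rv := lower_layer lv.
  have vw : v != w by apply: contraNneq lw => <-.
  have [rw | rw] := eqVneq (dist r w) m.
    by rewrite layer_m_adj // rw m_full; case: (full).
  have [rw' | rw'] := eqVneq (dist r w) m.+1.
    by rewrite adj_next ?rv // lv rw'; nat_lia.
  have [lt_w | le_w] := ltnP m.+1 (dist r w).
    by rewrite not_adj_far ?rv //; nat_lia.
  have rwm : dist r v = (dist r w).+1 by nat_lia.
  by rewrite adj_sym adj_next // lw; nat_lia.
have adj_p v w : p v != p w -> adj v w = (gap (p v) (p w) == 1).
  rewrite /p; have [lv | lv] := boolP (lower v); have [lw | lw] := boolP (lower w) => // pvw.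
  - by rewrite adj_lower // /gap; nat_lia.
  - by rewrite adj_sym adj_lower // /gap; nat_lia.
  have [rvw | rvw] := eqVneq (dist r w) (dist r v).+1.
    by rewrite adj_next // lv rvw /gap; nat_lia.
  have [rwv | rwv] := eqVneq (dist r v) (dist r w).+1.
    by rewrite adj_sym adj_next // lw rwv /gap; nat_lia.
  have -> : adj v w = false.
    apply/negP => vw; have := layer_adj_le vw.
    by rewrite adj_sym in vw; have := layer_adj_le vw; nat_lia.
  by rewrite /gap; nat_lia.
have root_twin v : lower v -> v \in twin_class r.
  move=> lv; have rv := lower_layer lv; apply/twin_classP => a ar av.
  have ra : 0 < dist r a by rewrite dist_gt0 // eq_sym.
  have [la | la] := boolP (lower a); last first.
    by rewrite [RHS]adj_sym (adj_lower v a) // adj_sym dist_eq1.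
  rewrite (@layer_m_adj a v) // ?lower_layer // adj_sym -dist_eq1 // lower_layer // m_full.
  by case: (full).
apply: twin_free_layout => // [v | i iD | v w].
- by case: ifP.
- have [im | im] := eqVneq i m; first by exists x; rewrite (negPf lower_x) im.
  have [v rv] := layer_nonempty connG dist_r_max iD.
  by exists v; rewrite /lower rv (negPf im).
have root_eq a : dist r a = 0 -> a = r by move/eqP; rewrite dist_eq0 // => /eqP.
have [lv | lv] := boolP (lower v); have [lw | lw] := boolP (lower w) => rvw.
- by apply: layer_m_twins; rewrite ?lower_layer // lv lw.
- by rewrite (root_eq w) // twin_class_sym root_twin.
- by rewrite (root_eq v) // root_twin.
have [lt_v | lt_v | eq_v] := ltngtP (dist r v) m.
- exact: below.
- by rewrite (above lt_v (w := w)) ?twin_class_refl.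
by apply: layer_m_twins; rewrite -?rvw // (negPf lv) (negPf lw).
Qed.

Let side (A : {set path_graph D}) v : add_vertex A :=
  if lower v then None else Some (u D (dist r v)).

(** The lower class becomes the added vertex. It is joined to layer [m - 1], and to the rest of
    layer [m] exactly when that layer is complete, so one argument serves both added-vertex
    graphs. *)
Let side_blowup A : twin_free (add_vertex A) ->
    (forall j : 'I_D.+1, ((j : path_graph D) \in A) =
       (j.+1 == m :> nat) || full && (j == m :> nat)) ->
  blowup (side A).
Proof.
move=> freeA AE; have val_ud v : (u D (dist r v) : 'I_D.+1) = dist r v :> nat by apply: val_u.
have eq_ud v w : (u D (dist r v) == u D (dist r w)) = (dist r v == dist r w).
  by rewrite -val_eqE /= !val_ud.
have adj_lower v w : lower v -> ~~ lower w ->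
    adj v w = ((dist r w).+1 == m) || full && (dist r w == m).
  move=> lv lw; have rv := lower_layer lv.
  have vw : v != w by apply: contraNneq lw => <-.
  have [rw | rw] := eqVneq (dist r w) m.
    by rewrite layer_m_adj // rw gtn_eqF //= andbT.
  rewrite andbF orbF; have [rw' | rw'] := eqVneq (dist r w) m.+1.
    by rewrite adj_next ?rv // lv rw'; nat_lia.
  have [rw2 | rw2] := eqVneq (dist r w).+1 m.
    by rewrite adj_sym adj_next ?rv.
  apply/negP => wv; have := layer_adj_le wv.
  by rewrite adj_sym in wv; have := layer_adj_le wv; nat_lia.
apply: twin_free_blowup => // [[j|]|v w|v w]; rewrite /side.
- have j_lt := ltn_ord (j : 'I_D.+1).
  have [jm | jm] := eqVneq ((j : 'I_D.+1) : nat) m.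
    by exists x; rewrite (negPf lower_x); congr Some; apply: val_inj; rewrite /= val_ud rx jm.
  have [v rv] := layer_nonempty connG dist_r_max (j_lt : (j : 'I_D.+1) <= D).
  exists v; rewrite /lower rv (negPf jm) /=; congr Some; apply: val_inj.
  by rewrite /= -rv val_ud.
- by exists y; rewrite lower_y.
- have [lv | lv] := boolP (lower v); have [lw | lw] := boolP (lower w) => //= pvw.
  + by rewrite AE val_ud adj_lower.
  + by rewrite AE val_ud adj_sym adj_lower.
  have {}pvw : dist r v != dist r w by apply: contraNneq pvw => ->.
  rewrite /path_adj !val_ud; have [rvw | rvw] := eqVneq (dist r v).+1 (dist r w).
    by rewrite adj_next // lv.
  have [rwv | rwv] := eqVneq (dist r w).+1 (dist r v).
    by rewrite adj_sym adj_next // lw.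
  apply/negP => vw; have := layer_adj_le vw.
  by rewrite adj_sym in vw; have := layer_adj_le vw; nat_lia.
have [lv | lv] := boolP (lower v); have [lw | lw] := boolP (lower w) => //.
  by move=> _; apply: layer_m_twins; rewrite ?lower_layer // lv lw.
move/Some_inj/eqP; rewrite eq_ud => /eqP rvw.
have [lt_v | lt_v | eq_v] := ltngtP (dist r v) m.
- exact: below.
- by rewrite (above lt_v (w := w)) ?twin_class_refl.
by apply: layer_m_twins; rewrite -?rvw // (negPf lv) (negPf lw).
Qed.

Let side_Some A v (j : nat) : j <= D -> side A v = Some (u D j) -> dist r v = j /\ ~~ lower v.
Proof.
move=> jD; rewrite /side; case: ifP => // lv /Some_inj/(congr1 val) /=.
by rewrite !val_u.
Qed.

Let side_None A v : side A v = None -> lower v.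
Proof. by rewrite /side; case: ifP. Qed.

(** With [j = m - 1], [below_singletons] gives the completeness of layer [m - 1] and the singletons
    before it; [above] gives those after layer [m]. *)
Lemma full_case3 : full -> 1 < m -> case3 G D.
Proof.
move=> full1 m_gt1; have kD : 2 <= m <= D.-1 by nat_lia.
have freeP := path_triangle_twin_free D_ge3 kD.
have blowup_s : blowup (side [set u D m.-1; u D m]).
  by apply: side_blowup => // j; rewrite !inE !eq_u ?full1 /=; nat_lia.
have [f iso_f val_f] := blowup_iso blowup_s; exists m => //; exists f => // cycle h'.
have [[f' fK f'K] _] := iso_f; have [phi_surj _ _] := blowup_s.
have [single1 adj1] : (forall v w, dist r v < m.-1 -> dist r v = dist r w -> v = w) /\
  (forall v w, dist r v = m.-1 -> dist r w = m.-1 -> v != w -> adj v w = full).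
  by apply: below_singletons; rewrite ?full1; nat_lia.
rewrite -(f'K h'); move: (f' h') => h; rewrite !inE !(inj_eq (can_inj fK)).
case: ifP => [/orP[/orP[]|] /eqP-> | h_out].
- apply/(type1K_fiber val_f phi_surj) => v w vw /side_None/lower_layer rv /side_None/lower_layer rw.
  by rewrite layer_m_adj.
- apply/(type1K_fiber val_f phi_surj) => v w vw /side_Some[|rv _]; first nat_lia.
  by move=> /side_Some[|rw _]; [nat_lia | rewrite adj1].
- apply/(type1K_fiber val_f phi_surj) => v w vw /side_Some[|rv _]; first nat_lia.
  by move=> /side_Some[|rw _]; [nat_lia | rewrite layer_m_adj].
apply/(type1_fiber val_f phi_surj) => v w; case: h h_out => // j.
rewrite -[j]inord_val -[inord j]/(u D (j : 'I_D.+1)) => h_out.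
have jD : (j : 'I_D.+1) <= D by rewrite -ltnS.
move=> /side_Some[] // rv _ /side_Some[] // rw _.
have [jm jm1] : (j : 'I_D.+1) != m :> nat /\ (j : 'I_D.+1) != m.-1 :> nat.
  by split; apply: contraFneq h_out => ->; rewrite eqxx ?orbT.
have [lt_j | le_j] := ltnP (j : 'I_D.+1) m; first by apply: single1; nat_lia.
by apply: above; nat_lia.
Qed.

(** Layer [m - 1] is the degree-3 vertex, of unrestricted type. Its neighbours are the two parts of
    layer [m] and layer [m - 2], which [below_singletons] treats with [j = m - 2]. *)
Lemma empty_case2 : ~~ full -> 2 < m -> case2 G D.
Proof.
move=> full0 m_gt2; have kD : 3 <= m <= D.-1 by nat_lia.
have freeP := path_pendant_twin_free kD.
have blowup_s : blowup (side [set u D m.-1]).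
  by apply: side_blowup => // j; rewrite !inE !eq_u ?(negPf full0) /=; nat_lia.
have [f iso_f val_f] := blowup_iso blowup_s; exists m => //; exists f => // c.
have [[f' fK f'K] adj_f] := iso_f; have [phi_surj _ _] := blowup_s.
have [single1 adj1] : (forall v w, dist r v < m - 2 -> dist r v = dist r w -> v = w) /\
  (forall v w, dist r v = m - 2 -> dist r w = m - 2 -> v != w -> adj v w = full).
  by apply: below_singletons; rewrite ?(negPf full0); nat_lia.
have homN h : (forall v w, side [set u D m.-1] v = h -> side [set u D m.-1] w = h ->
    v != w -> adj v w = full) -> type1N (f h).
  move=> hN; apply/(type1N_fiber val_f phi_surj) => v w vh wh.
  by have [-> | vw] := eqVneq v w; [rewrite adj_irr | rewrite hN].
split=> C; rewrite -(f'K C); move: (f' C) => {C}.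
  case=> [j|]; rewrite adj_f => cj; apply: homN => v w; last first.
    by move=> /side_None/lower_layer rv /side_None/lower_layer rw vw; rewrite layer_m_adj.
  have jD : (j : 'I_D.+1) <= D by rewrite -ltnS.
  have {cj} jm : (j : 'I_D.+1) = m :> nat \/ (j : 'I_D.+1) = m - 2 :> nat.
    by move: cj; rewrite /= /path_adj val_u; nat_lia.
  rewrite -[j]inord_val -[inord j]/(u D (j : 'I_D.+1)).
  move=> /side_Some[] // rv _ /side_Some[] // rw _ vw.
  by case: jm => jm; [rewrite layer_m_adj | rewrite adj1]; rewrite ?rv ?rw.
case=> [j|]; rewrite (inj_eq (can_inj fK)) adj_f => jc cj; last first.
  by rewrite /= inE eqxx in cj.
apply/(type1_fiber val_f phi_surj) => v w; move: jc cj.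
have jD : (j : 'I_D.+1) <= D by rewrite -ltnS.
rewrite -[j]inord_val -[inord j]/(u D (j : 'I_D.+1)) => jc cj.
move=> /side_Some[] // rv _ /side_Some[] // rw _.
have jm1 : (j : 'I_D.+1) != m.-1 :> nat by apply: contraNneq jc => ->.
move: cj; rewrite /= /path_adj !val_u //; last nat_lia.
have [lt_j | le_j] := ltnP (j : 'I_D.+1) (m - 2); first by move=> _; apply: single1; nat_lia.
by move=> cj; apply: above; move: cj; nat_lia.
Qed.

End TwoClassLayer.

Lemma extremal_structure : (exists p : G -> nat, path_layout D p) \/ case2 G D \/ case3 G D.
Proof.
have [/existsP[x /existsP[y /andP[/eqP rxy xy]]] | no_xy] :=
    boolP [exists x, exists y, (dist r x == dist r y) && (y \notin twin_class x)]; last first.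
  left; exists (dist r); apply: one_class_layers => v w rvw; apply: contraT => vw.
  by case/existsP: no_xy; exists v; apply/existsP; exists w; rewrite rvw eqxx.
have [z [rz z_uniq zxy]] := nontwin_layer connG dist_r_max maxT rxy xy.
wlog zx : x y rxy xy rz zxy / adj z x.
  move=> IH; have [zx | zx] := boolP (adj z x); first exact: (IH x y).
  apply: (IH y x); rewrite -?rxy //; first by rewrite twin_class_sym.
    by rewrite eq_sym.
  by case: (adj z y) zxy => //; rewrite (negPf zx).
have zy : ~~ adj z y by rewrite zx in zxy; case: (adj z y) zxy.
have [m rx] : exists m, dist r x = m by exists (dist r x).
have ry : dist r y = m by rewrite -rxy.
rewrite rx in rz; have m_gt0 : 0 < m.
  rewrite -rx dist_gt0 //; apply: contraNneq xy => r_x.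
  suff -> : y = x by apply: twin_class_refl.
  by apply/eqP; rewrite -(dist_eq0 connG) dist_sym // -{1}r_x -rxy -r_x distxx.
have bound := two_class_layer_bound rx ry xy rz z_uniq zx zy.
(* At the smallest possible [m] the lower class folds onto the class of [r]; beyond it, the class is
   an added vertex. *)
have [short | long] := eqVneq m (if adj x y then 1 else 2).
  by left; eexists; apply: (short_path_layout rx ry xy rz z_uniq zx short).
right; case: (boolP (adj x y)) bound long => full bound long.
  by right; apply: (full_case3 rx ry xy rz z_uniq zx zy) => //; lia.
by left; apply: (empty_case2 rx ry xy rz z_uniq zx zy) => //; move: bound; rewrite /=; lia.
Qed.

End Structure.

Theorem theorem2p14 (G : sgraph) (n D : nat) :
  connected G -> #|G| = n -> diameter G = D -> 3 <= D ->
  (metric_dim G = n - D <-> case1 G D \/ case2 G D \/ case3 G D).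
Proof.
move=> connG <- diamG D_ge3.
have dist_le (x y : G) : dist x y <= D.
  by rewrite -diamG; apply: leq_trans (leq_bigmax x); apply: (leq_bigmax y).
have [r [w rw]] : exists r w : G, dist r w = D.
  (* An empty graph would have diameter 0; a nonempty one attains its maximal distance. *)
  have G_gt0 : 0 < #|G|.
    rewrite lt0n; apply: contraTneq D_ge3 => /card0_eq G0.
    by rewrite -diamG /diameter big_pred0.
  have [r rmax] := eq_bigmax (fun x : G => \max_(y : G) dist x y) G_gt0.
  have [w wmax] := eq_bigmax (dist r) G_gt0.
  by exists r, w; rewrite -wmax -rmax.
have r_max : exists w, dist r w = D by exists w.
have D_le : D <= #|G| by rewrite -rw ltnW // dist_lt_card.
apply: iff_trans (metric_dim_cardP connG D_le (coresolving_diameter connG r_max)) _.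
split=> [maxT | [[[f iso_f] cases] | [c2 | c3]]]; last first.
- exact: case3_max_coresolving.
- exact: case2_max_coresolving.
- have [phi blowup_phi val_f] := iso_blowup iso_f.
  exact/(path_metric_dim connG D_ge3 (blowup_layout blowup_phi) iso_f).
case: (extremal_structure connG D_ge3 dist_le r_max maxT) => [[p layout_p]|]; last by right.
left; have [phi blowup_phi pE] := layout_blowup layout_p.
have [f iso_f val_f] := blowup_iso blowup_phi; split; first by exists f.
apply/(path_metric_dim connG D_ge3 layout_p iso_f) => // i.
by rewrite val_f; apply/setP => x; rewrite !inE pE.
Qed.
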